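(* Let $G_1$ be any tree and $G_2$ any non-trivial graph. \begin{itemize} \item[(1)] If $\operatorname{diam} G_1\ge 3$, then $\delta(G_1\circ G_2)=3/2$. \item[(2)] If $1\le \operatorname{diam} G_1\le 2$, then $\delta(G_1\circ G_2)=3/2$ if and only if $G_2\in\mathcal{F}$. \item[(3)] If $G_1$ is trivial, then $\delta(G_1\circ G_2)=3/2$ if and only if $\delta(G_2)=3/2$. \end{itemize}
   Context: All graphs are simple and connected (possibly infinite) and every edge has length $1$. A graph $G$ is viewed as a geodesic metric space by identifying each edge isometrically with $[0,1]$; points of $G$ are its vertices and the interior points of its edges, $d_G$ is the length of a shortest path, and $\operatorname{diam} G=\sup\{d_G(x,y): x,y\in G\}$ (over all points, not only vertices). A graph is trivial if it has a single vertex (this is regarded as a tree), and non-trivial otherwise. Lexicographic product $G_1\circ G_2$: vertex set $V(G_1)\times V(G_2)$; two distinct vertices $(u_1,v_1)$ and $(u_2,v_2)$ are adjacent if either $[u_1,u_2]\in E(G_1)$, or $u_1=u_2$ and $[v_1,v_2]\in E(G_2)$. A geodesic triangle $T=\{x_1,x_2,x_3\}$ in a geodesic metric space $X$ is the union of three geodesics $[x_1x_2],[x_2x_3],[x_3x_1]$. It is $\delta$-thin if every point of each side is at distance at most $\delta$ from the union of the other two sides; $\delta(T)=\inf\{\delta\ge 0: T \text{ is } \delta\text{-thin}\}$ and $\delta(X)=\sup\{\delta(T): T \text{ a geodesic triangle in } X\}\in[0,\infty]$. The family $\mathcal{F}$. Let $C_n$ be the cycle graph with vertices $v_1,\dots,v_n$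 and edges $[v_i,v_{i+1}]$ ($1\le i\le n-1$) and $[v_n,v_1]$. Define the following sets of graphs, where ''subset'' may be empty, proper, or the whole set: - $\mathcal{C}_6^{(1)}$: graphs obtained from $C_6$ by adding a subset of the edges $\{[v_2,v_6],[v_4,v_6]\}$; - $\mathcal{C}_7^{(1)}$: graphs obtained from $C_7$ by adding a subset of $\{[v_2,v_6],[v_2,v_7],[v_4,v_6],[v_4,v_7]\}$; - $\mathcal{C}_8^{(1)}$: graphs obtained from $C_8$ by adding a subset of $\{[v_2,v_6],[v_2,v_8],[v_4,v_6],[v_4,v_8]\}$; - $\mathcal{C}_8^{(2)}$: graphs obtained from $C_8$ by adding a subset of $\{[v_2,v_8],[v_4,v_6],[v_4,v_7],[v_4,v_8]\}$; - $\mathcal{C}_9^{(1)}$: graphs obtained from $C_9$ by adding a subset of $\{[v_2,v_6],[v_2,v_9],[v_4,v_6],[v_4,v_9]\}$. $\mathcal{F}$ is the set of all graphs containing, as an induced subgraph, a graph isomorphic to some element of $\mathcal{C}_6^{(1)}\cup\mathcal{C}_7^{(1)}\cup\mathcal{C}_8^{(1)}\cup\mathcal{C}_8^{(2)}\cup\mathcal{C}_9^{(1)}$. *)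

(* Defs.v *)
From HB Require Import structures.
From mathcomp Require Import all_boot all_order all_algebra.
From mathcomp Require Import all_classical all_reals all_analysis.

Set Implicit Arguments.
Unset Strict Implicit.
Unset Printing Implicit Defensive.

Import Order.TTheory GRing.Theory Num.Theory.

Local Open Scope classical_set_scope.
Local Open Scope ring_scope.

(* Every graph is simple, connected and nonempty, with an arbitrary (possibly
   infinite) vertex set.  Decidability of equality and adjacency is no
   restriction here, since the ambient logic is classical. *)
Record graph := Graph {
  vertex :> eqType;
  adj : rel vertex;
  adj_sym : symmetric adj;
  adj_irr : irreflexive adj;
  graph_inhabited : inhabited vertex;
  adj_connected : forall u v : vertex, exists2 p, path adj u p & last u p = v
}.

Definition trivial_graph (G : graph) : Prop := exists v : G, forall w : G, w = v.

(* Connectedness being part of [graph], a tree is a graph without cycles. *)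
Definition tree (G : graph) : Prop :=
  forall c : seq G, ucycle (@adj G) c -> (size c < 3)%N.

Section Lexicographic.
Variables G1 G2 : graph.

Definition lex_adj : rel (G1 * G2)%type := fun x y =>
  adj x.1 y.1 || (x.1 == y.1) && adj x.2 y.2.

Lemma lex_adj_sym : symmetric lex_adj.
Proof. by move=> x y; rewrite /lex_adj adj_sym eq_sym [adj x.2 _]adj_sym. Qed.

Lemma lex_adj_irr : irreflexive lex_adj.
Proof. by move=> x; rewrite /lex_adj !adj_irr andbF. Qed.

Lemma lex_inhabited : inhabited (G1 * G2)%type.
Proof.
by case: (graph_inhabited G1) => u; case: (graph_inhabited G2) => v; exists.
Qed.

Lemma lex_connected (x y : (G1 * G2)%type) :
  exists2 p, path lex_adj x p & last x p = y.
Proof.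
case: x y => [u v] [u' v'].
have [<-|nuu'] := eqVneq u u'.
  have [p vp <-] := adj_connected v v'.
  exists [seq (u, w) | w <- p]; last by rewrite (last_map (pair u)).
  apply: (homo_path (f := pair u)) vp => a b ab.
  by rewrite /= /lex_adj /= eqxx ab orbT.
have [[|a p] /=] := adj_connected u u'.
  by move=> _ /eqP; rewrite (negPf nuu').
move=> /andP[ua ap] <-; exists [seq (w, v') | w <- a :: p].
  rewrite /= {1}/lex_adj /= ua /=.
  apply: (homo_path (f := pair^~ v')) ap => b c bc.
  by rewrite /= /lex_adj /= bc.
by rewrite /= (last_map (fun w => (w, v'))).
Qed.

Definition lex_product : graph :=
  Graph lex_adj_sym lex_adj_irr lex_inhabited lex_connected.

End Lexicographic.

Section GeometricRealization.
Variables (R : realType) (G : graph).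

(* Points are encoded by barycentric coordinates, so that a point determines
   its coordinate function and conversely.  [seg u v t] is the point at
   distance t from u on the edge [u, v] identified with [0, 1]. *)
Definition vtx (u : G) : G -> R := fun w => (w == u)%:R.

Definition seg (u v : G) (t : R) : G -> R := fun w =>
  (1 - t) * vtx u w + t * vtx v w.

Definition is_point (f : G -> R) : Prop :=
  (exists u, f = vtx u) \/
  (exists u v t, [/\ adj u v, 0 < t < 1 & f = seg u v t]).

Record point := Point { coord :> G -> R; coordP : is_point coord }.

(* [path_length x y l]: some path from x to y, made of finitely many straight
   moves each inside one closed edge, has total length l. *)
Inductive path_length : point -> point -> R -> Prop :=
| path_length_nil x : path_length x x 0
| path_length_cons x y z u v s t l :
    adj u v -> 0 <= s <= 1 -> 0 <= t <= 1 ->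
    coord x = seg u v s -> coord y = seg u v t ->
    path_length y z l -> path_length x z (`|s - t| + l).

Definition gdist (x y : point) : R := inf [set l | path_length x y l].

Definition diam : \bar R :=
  ereal_sup [set (gdist p.1 p.2)%:E | p in [set: point * point]].

End GeometricRealization.

Section Hyperbolicity.
Variables (R : realType) (X : Type) (d : X -> X -> R).

Definition geodesic (x y : X) (S : set X) : Prop :=
  exists g : R -> X,
    [/\ g 0 = x, g (d x y) = y,
        (forall s t, 0 <= s <= d x y -> 0 <= t <= d x y ->
           d (g s) (g t) = `|s - t|)
      & S = g @` [set t | 0 <= t <= d x y]].

Definition dist_to_set (x : X) (A : set X) : R := inf [set d x a | a in A].

(* A geodesic triangle is recorded by its three sides, as geodesics between
   given vertices need not be unique. *)
Definition geodesic_triangle (A B C : set X) : Prop :=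
  exists x1 x2 x3, [/\ geodesic x1 x2 A, geodesic x2 x3 B & geodesic x3 x1 C].

Definition thin (delta : R) (A B C : set X) : Prop :=
  [/\ forall p, A p -> dist_to_set p (B `|` C) <= delta,
      forall p, B p -> dist_to_set p (C `|` A) <= delta
    & forall p, C p -> dist_to_set p (A `|` B) <= delta].

Definition delta_triangle (A B C : set X) : \bar R :=
  ereal_inf [set delta%:E | delta in [set e | 0 <= e /\ thin e A B C]].

Definition delta_space : \bar R :=
  ereal_sup [set h | exists A B C,
    geodesic_triangle A B C /\ h = delta_triangle A B C].

End Hyperbolicity.

Definition hyp_const (R : realType) (G : graph) : \bar R :=
  delta_space (@gdist R G).

(* Edges between v_1, ..., v_n are written as pairs of indices starting at 1;
   the vertex v_k is the ordinal of value k - 1. *)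
Definition cycle_edges (n : nat) : seq (nat * nat) :=
  rcons [seq (i, i.+1) | i <- iota 1 n.-1] (n, 1%N).

Definition cycle_with_chords (n : nat) (chords : seq (nat * nat)) : rel 'I_n :=
  fun i j => let E := cycle_edges n ++ chords in
    ((i.+1, j.+1) \in E) || ((j.+1, i.+1) \in E).

Definition contains_induced (G : graph) (n : nat) (e : rel 'I_n) : Prop :=
  exists2 f : 'I_n -> G, injective f & forall i j, adj (f i) (f j) = e i j.

Definition chord_families : seq (nat * seq (nat * nat)) :=
  [:: (6, [:: (2, 6); (4, 6)]);
      (7, [:: (2, 6); (2, 7); (4, 6); (4, 7)]);
      (8, [:: (2, 6); (2, 8); (4, 6); (4, 8)]);
      (8, [:: (2, 8); (4, 6); (4, 7); (4, 8)]);
      (9, [:: (2, 6); (2, 9); (4, 6); (4, 9)])]%N.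

Definition family_F (G : graph) : Prop :=
  exists n allowed chords,
    [/\ (n, allowed) \in chord_families, {subset chords <= allowed}
      & contains_induced G (@cycle_with_chords n chords)].

(* Main.v *)
(* Write H for the lexicographic product.  Distinct fibres of H over adjacent
   vertices of G1 are completely joined, so two vertices of one fibre are at
   distance at most 2 in H as soon as G1 is non-trivial, and every edge of the
   tree G1 is a bridge that the other two sides of a triangle have to cross.
   This gives the bound 3/2.

   A path a b c e without backtracking in G1 gives a geodesic bigon with sides
   (a,y)(b,y)(c,y)(e,y) and (a,y)(b,y')(c,y')(e,y), and the midpoint of
   (b,y)(c,y) is at distance 3/2 from the second side.

   Without such a path G1 is a star and H has diameter 2 on vertices.  A point p
   of a side [xy] at distance more than 5/4 from the other sides is then close
   to the middle vertex of an induced path v1 v2 v3 v4 v5, with x and y in the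
   edges v1 v2 and v4 v5, and the other sides stay among the vertices not
   adjacent to v3.  Hence the whole triangle lives in a single fibre, a copy of
   G2.  Following the other sides from v1 and from v5 yields a walk with at most
   four inner vertices; shortening it along its chords gives a cycle of the
   family F, the forbidden chords being those that would shorten a geodesic. *)

From mathcomp Require Import all_boot all_order all_algebra.
From mathcomp Require Import all_classical all_reals all_analysis.
From mathcomp Require Import ring lra zify.
Require Import Defs.

Set Implicit Arguments.
Unset Strict Implicit.
Unset Printing Implicit Defensive.

Import Order.TTheory GRing.Theory Num.Theory.

Local Open Scope classical_set_scope.
Local Open Scope ring_scope.

(** * Distance between vertices *)

(** Two obstacles shape the argument. Distances are infima over paths between points that may lie
    inside edges, and the hyperbolicity constant is a supremum over triangles; neither is attained
    by definition. For distances, an optimal route leaves the edge of a point through one of at most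
    two ends, which turns the infimum into a minimum and reduces estimates to distances between
    vertices. For the constant, the star case proves a gap: any value above 5/4 forces a member of
    F, and such a member gives 3/2. The number 5/4 is 1 + 1/4: in diameter 2 the far point p is
    within 1/4 of v3, so every neighbour of v3 is within 5/4 of p and cannot lie on the other sides.
    Induced cycles, rather than isometric ones, suffice because leaving a fibre and coming back
    costs at least 2, and the lower bound drawn from F never asks for a vertex distance above 2. *)

Section VertexDistance.
Variable G : graph.
Implicit Types (u v w : G) (p : seq G).

Lemma vdist_subproof u v :
  exists n, `[< exists p, [/\ path (@adj G) u p, last u p = v & size p = n] >].
Proof.
have [p up vp] := adj_connected u v.
by exists (size p); apply/asboolP; exists p.
Qed.

Definition vdist u v : nat := ex_minn (vdist_subproof u v).

Lemma vdist_path u v :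
  exists p, [/\ path (@adj G) u p, last u p = v & size p = vdist u v].
Proof. by rewrite /vdist; case: ex_minnP => n /asboolP. Qed.

Lemma vdist_le u p : path (@adj G) u p -> (vdist u (last u p) <= size p)%N.
Proof.
move=> up; rewrite /vdist; case: ex_minnP => n _; apply.
by apply/asboolP; exists p.
Qed.

Lemma vdistxx u : vdist u u = 0%N.
Proof. by apply/eqP; rewrite -leqn0 (@vdist_le u [::]). Qed.

Lemma vdist0 u v : vdist u v = 0%N -> u = v.
Proof. by have [[|w p] [_ <- <-]] := vdist_path u v. Qed.

Lemma vdist_tri u v w : (vdist u w <= vdist u v + vdist v w)%N.
Proof.
have [p [up pv <-]] := vdist_path u v; have [q [vq qw <-]] := vdist_path v w.
rewrite -size_cat -qw -pv -last_cat; apply: vdist_le.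
by rewrite cat_path up pv.
Qed.

Lemma vdist_adj u v : adj u v -> (vdist u v <= 1)%N.
Proof. by move=> uv; apply: (@vdist_le u [:: v]); rewrite /= uv. Qed.

Lemma vdistS u v n :
  vdist u v = n.+1 -> exists2 w, adj u w & vdist w v = n.
Proof.
move=> uvn; have [[|w p] [/= up pv]] := vdist_path u v; first by rewrite uvn.
rewrite uvn => -[pn]; move: up => /andP[uw wp]; exists w => //.
apply/eqP; rewrite eqn_leq; apply/andP; split; first by rewrite -pn -pv vdist_le.
by rewrite -ltnS -uvn (leq_trans (vdist_tri u w v))// -add1n leq_add2r vdist_adj.
Qed.

Lemma vdist1 u v : vdist u v = 1%N -> adj u v.
Proof. by move=> /vdistS[w uw /vdist0 <-]. Qed.

Lemma vdistC_le u v : (vdist u v <= vdist v u)%N.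
Proof.
elim: {v}(vdist v u) {-2}v (erefl (vdist v u)) => [|n IHn] w wu; rewrite wu.
  by rewrite (vdist0 wu) vdistxx.
have [x wx /[dup] xu /IHn] := vdistS wu; rewrite xu => uxn.
rewrite -addn1 (leq_trans (vdist_tri u x w))// leq_add// vdist_adj//.
by rewrite adj_sym.
Qed.

Lemma vdistC u v : vdist u v = vdist v u.
Proof. by apply/eqP; rewrite eqn_leq !vdistC_le. Qed.

Lemma adj_neq u v : adj u v -> u != v.
Proof. by apply: contraTneq => ->; rewrite adj_irr. Qed.

Lemma vdist_gt0 u v : u != v -> (0 < vdist u v)%N.
Proof. by rewrite lt0n; apply: contraNneq => /vdist0 ->. Qed.

Lemma vdist_gt1 u v : u != v -> ~~ adj u v -> (1 < vdist u v)%N.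
Proof.
move=> uv nuv; have := vdist_gt0 uv.
by case E: (vdist u v) => [|[|n]] // _; move: nuv; rewrite vdist1.
Qed.

Lemma vdist_gt2 u v : u != v -> ~~ adj u v ->
  (forall w, adj u w -> ~~ adj w v) -> (2 < vdist u v)%N.
Proof.
move=> uv nuv nw; have := vdist_gt1 uv nuv.
case E: (vdist u v) => [|[|[|n]]] // _.
by have [w uw /vdist1 wv] := vdistS E; have := nw _ uw; rewrite wv.
Qed.

Lemma vdist_le2 u v w : adj u w -> adj w v -> (vdist u v <= 2)%N.
Proof. by move=> uw wv; apply: (@vdist_le u [:: w; v]); rewrite /= uw wv. Qed.

Lemma adj_ind (P : G -> Prop) u :
  P u -> (forall v w, adj v w -> P v -> P w) -> forall v, P v.
Proof.
move=> Pu PS v; have [p up <-] := adj_connected u v.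
elim: p u Pu up => //= w p IHp u Pu /andP[uw wp].
by apply: IHp wp; apply: PS uw Pu.
Qed.

Lemma exists_adj : ~ trivial_graph G -> forall u, exists v, adj u v.
Proof.
move=> ntG u; apply: contrapT => nadj; apply: ntG; exists u => w.
have [[|v p] /=] := adj_connected u w; first by [].
by case/andP=> uv _ _; case: nadj; exists v.
Qed.

End VertexDistance.

(** * The metric of the geometric realization *)

Section Metric.
Variables (R : realType) (G : graph).
Implicit Types (u v w : G) (x y z : point R G) (s t l : R).

Lemma point_eq x y : coord x = coord y -> x = y.
Proof.
by case: x y => [f Pf] [g Pg] /= fg; subst g; congr Point; apply: Prop_irrelevance.
Qed.

Lemma segE u v t w : seg u v t w = (1 - t) * (w == u)%:R + t * (w == v)%:R :> R.
Proof. by []. Qed.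

Lemma seg0 u v : seg u v 0 = vtx R u.
Proof. by apply/funext => w; rewrite segE /vtx subr0 mul1r mul0r addr0. Qed.

Lemma seg1 u v : seg u v 1 = vtx R v.
Proof. by apply/funext => w; rewrite segE /vtx subrr mul1r mul0r add0r. Qed.

Lemma segC u v t : seg u v t = seg v u (1 - t).
Proof. apply/funext => w; rewrite !segE.
by move: (_ == u)%:R (_ == v)%:R => a b; rewrite subKr addrC. Qed.

Lemma segl u v t : adj u v -> seg u v t u = 1 - t.
Proof. by move=> /adj_neq uv; rewrite segE eqxx (negPf uv) mulr1 mulr0 addr0. Qed.

Lemma segr u v t : adj u v -> seg u v t v = t.
Proof. by rewrite adj_sym segC => /segl ->; rewrite subKr. Qed.

Lemma seg_supp u v t w : 0 < seg u v t w -> w = u \/ w = v.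
Proof.
rewrite segE; have [->|wu] := eqVneq w u; first by left.
have [->|wv] := eqVneq w v; first by right.
by rewrite !mulr0 addr0 ltxx.
Qed.

Lemma vtxE u w : vtx R u w = (w == u)%:R. Proof. by []. Qed.

Lemma vtx_supp u w : 0 < vtx R u w -> w = u.
Proof. by rewrite vtxE; have [->|] := eqVneq; rewrite ?ltxx. Qed.

Definition vpt u : point R G := Point (or_introl (ex_intro _ u erefl)).

Lemma is_point_seg u v t : adj u v -> 0 <= t <= 1 -> is_point (seg u v t).
Proof.
move=> uv /andP[]; rewrite !le_eqVlt => /predU1P[<-|t0].
  by left; exists u; rewrite seg0.
move=> /predU1P[->|t1]; first by left; exists v; rewrite seg1.
by right; exists u, v, t; rewrite t0 t1.
Qed.

Lemma point_rep x : (exists u, x = vpt u) \/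
  exists u v t, [/\ adj u v, 0 < t < 1 & coord x = seg u v t].
Proof.
have [[u xu]|[u [v [t xt]]]] := coordP x; [left|right; by exists u, v, t].
by exists u; apply: point_eq.
Qed.

(* For w in the support of x, 1 - x w is the distance from x to w along an edge. *)
Lemma supp_rep x w : 0 < x w -> x = vpt w \/
  exists v t, [/\ adj w v, 0 < t < 1 & coord x = seg w v t].
Proof.
have [[u ->] /= /vtx_supp ->|[u [v [t [uv /andP[t0 t1] xt]]]]] := point_rep x.
  by left.
rewrite xt => /seg_supp[]->; right; first by exists v, t; rewrite t0 t1.
by exists u, (1 - t); rewrite adj_sym -segC uv; split => //; apply/andP; split; lra.
Qed.

Lemma exists_supp x : exists w, 0 < x w.
Proof.
have [[u ->]|[u [v [t [uv /andP[t0 t1] ->]]]]] := point_rep x.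
  by exists u; rewrite /= vtxE eqxx.
by exists u; rewrite segl// subr_gt0.
Qed.

Lemma coord_le1 x w : x w <= 1.
Proof.
have [xw|xw] := ltP 0 (x w); last by apply: le_trans xw _.
have [->|[v [t [wv /andP[t0 t1] ->]]]] := supp_rep xw.
  by rewrite /= vtxE eqxx.
by rewrite segl//; lra.
Qed.

Lemma coord1 x w : 1 <= x w -> x = vpt w.
Proof.
move=> xw; have [//|[v [t [wv /andP[t0 t1] xt]]]] := supp_rep (lt_le_trans ltr01 xw).
by move: xw; rewrite xt segl// => xw; exfalso; lra.
Qed.

Lemma supp_adj x w w' : 0 < x w -> 0 < x w' -> w = w' \/ adj w w'.
Proof.
move=> /supp_rep[->/= /vtx_supp ->|[v [t [wv _ ->]]]]; first by left.
by move=> /seg_supp[]->; [left|right].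
Qed.

Lemma path_length_ge0 x y l : path_length x y l -> 0 <= l.
Proof. by elim=> // *; rewrite addr_ge0. Qed.

Lemma path_length_cat x y z l l' :
  path_length x y l -> path_length y z l' -> path_length x z (l + l').
Proof.
elim=> [?|{}x a {}y u v s t {}l uv s01 t01 xs ys _ IH] yz; first by rewrite add0r.
by rewrite -addrA; apply: (path_length_cons uv s01 t01 xs ys); apply: IH.
Qed.

Lemma path_length_edge u v s t x y : adj u v -> 0 <= s <= 1 -> 0 <= t <= 1 ->
  coord x = seg u v s -> coord y = seg u v t -> path_length x y `|s - t|.
Proof.
move=> uv s01 t01 xs ys; rewrite -[`|_|]addr0.
by apply: (path_length_cons uv s01 t01 xs ys); apply: path_length_nil.
Qed.

Lemma path_lengthC x y l : path_length x y l -> path_length y x l.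
Proof.
elim=> [?|{}x a {}y u v s t {}l uv s01 t01 xs ys _ IH]; first exact: path_length_nil.
by rewrite addrC distrC; apply: path_length_cat IH _; apply: path_length_edge ys xs.
Qed.

Lemma path_length_vertex u p :
  path (@adj G) u p -> path_length (vpt u) (vpt (last u p)) (size p)%:R.
Proof.
elim: p u => [|v p IHp] u /=; first by move=> _; apply: path_length_nil.
move=> /andP[uv /IHp vp]; rewrite -natr1 addrC.
have -> : 1 + (size p)%:R = `|0 - 1| + (size p)%:R :> R by rewrite sub0r normrN1.
by apply: (@path_length_cons R G _ (vpt v) _ u v 0 1) => //=;
  rewrite ?seg0 ?seg1 ?lexx ?ler01.
Qed.

Lemma path_length_supp x w : 0 < x w -> path_length x (vpt w) (1 - x w).
Proof.
move=> /supp_rep[->|[v [t [wv /andP[t0 t1] xt]]]].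
  by rewrite /= vtxE eqxx subrr; apply: path_length_nil.
rewrite xt segl//; have -> : 1 - (1 - t) = `|t - 0| by rewrite subr0 gtr0_norm//; ring.
by apply: (path_length_edge wv) => //=; rewrite ?lexx ?ler01 ?seg0// !ltW.
Qed.

Lemma path_length_exists x y : exists l, path_length x y l.
Proof.
have [u /path_length_supp xu] := exists_supp x.
have [v /path_length_supp yv] := exists_supp y.
have [p /path_length_vertex up puv] := adj_connected u v.
eexists; apply: path_length_cat xu _; apply: path_length_cat up _.
by rewrite puv; apply: path_lengthC yv.
Qed.

Lemma gdist_lbound x y : has_lbound [set l | path_length x y l].
Proof. by exists 0 => l /path_length_ge0. Qed.

Lemma gdist_le x y l : path_length x y l -> gdist x y <= l.
Proof. by move=> xyl; apply: ge_inf xyl; apply: gdist_lbound. Qed.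

Lemma le_gdist x y c : (forall l, path_length x y l -> c <= l) -> c <= gdist x y.
Proof.
move=> xyc; apply: lb_le_inf => [|l /xyc//].
by have [l] := path_length_exists x y; exists l.
Qed.

Lemma gdist_lt x y c : gdist x y < c -> exists2 l, path_length x y l & l < c.
Proof.
move=> xyc; apply: contrapT => nex; move: xyc; rewrite ltNge => /negP; apply.
apply: le_gdist => l xyl; rewrite leNgt; apply/negP => lc.
by apply: nex; exists l.
Qed.

Lemma gdist_ge0 x y : 0 <= gdist x y.
Proof. by apply: le_gdist => l /path_length_ge0. Qed.

Lemma gdistxx x : gdist x x = 0.
Proof.
by apply/eqP; rewrite eq_le gdist_ge0 andbT gdist_le//; apply: path_length_nil.
Qed.

Lemma gdistC x y : gdist x y = gdist y x.
Proof. by congr inf; apply/seteqP; split => l; apply: path_lengthC. Qed.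

Lemma gdist_tri y x z : gdist x z <= gdist x y + gdist y z.
Proof.
rewrite -lerBlDr; apply: le_gdist => l xyl; rewrite lerBlDr -lerBlDl.
apply: le_gdist => l' yzl'; rewrite lerBlDl; apply: gdist_le.
exact: path_length_cat xyl yzl'.
Qed.

Lemma gdist_edge u v s t x y : adj u v -> 0 <= s <= 1 -> 0 <= t <= 1 ->
  coord x = seg u v s -> coord y = seg u v t -> gdist x y <= `|s - t|.
Proof. by move=> uv s01 t01 xs yt; apply: gdist_le; apply: path_length_edge xs yt. Qed.

Lemma gdist_supp x w : 0 < x w -> gdist x (vpt w) <= 1 - x w.
Proof. by move=> /path_length_supp; apply: gdist_le. Qed.

Lemma vdist_adj_tri a b v : adj a b ->
  (vdist a v)%:R <= 1 + (vdist b v)%:R :> R.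
Proof.
move=> ab; have : (vdist a v <= 1 + vdist b v)%N.
  by rewrite (leq_trans (vdist_tri a b v))// leq_add2r vdist_adj.
by rewrite -(ler_nat R) natrD.
Qed.

(** By induction on the moves of the path, which must leave the edge of x through one of its ends w.
    This end has to lie in the support of x, since otherwise [1 - x w] would not be a distance; when
    x sits at one end of the edge of the move, that end is chosen. *)
Lemma path_length_to_vertex x v l : path_length x (vpt v) l ->
  exists w, 0 < x w /\ 1 - x w + (vdist w v)%:R <= l.
Proof.
move=> xl; move Ey: (vpt v) xl => y xl.
elim: xl Ey => {x y l}[x <-|x y z a b s t l ab /andP[s0 s1] /andP[t0 t1] xs yt _ IH zv].
  by exists v; rewrite /= vtxE eqxx vdistxx subrr addr0.
have {IH} [w [yw wl]] := IH zv.
have dab := vdist_adj_tri v ab; have dba : (vdist b v)%:R <= 1 + (vdist a v)%:R :> R.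
  by apply: vdist_adj_tri; rewrite adj_sym.
have st : s - t <= `|s - t| /\ t - s <= `|s - t|.
  by rewrite ler_norm distrC ler_norm.
move: yw wl; rewrite yt => /[dup] /seg_supp[]->; rewrite ?segl ?segr// => _ wl.
  have [s_lt1|s_ge1] := ltP s 1; [exists a|exists b]; rewrite xs ?segl ?segr//; lra.
have [s_gt0|s_le0] := ltP 0 s; [exists b|exists a]; rewrite xs ?segl ?segr//; lra.
Qed.


(* Supports have at most two elements, so a bound of this form passes from the
   lengths of the paths to their infimum. *)
Lemma ge_gdist_alt x y e (c : G -> R) :
  (forall l, path_length x y l -> e <= l \/ exists w, 0 < x w /\ c w <= l) ->
  e <= gdist x y \/ exists w, 0 < x w /\ c w <= gdist x y.
Proof.
move=> alt; apply: contrapT => /not_orP[/negP]; rewrite -ltNge => de nex.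
have {nex} dc w : 0 < x w -> gdist x y < c w.
  by move=> xw; rewrite ltNge; apply/negP => cw; apply: nex; exists w.
suff [m dm mP] : exists2 m, gdist x y < m & forall w, 0 < x w -> m <= c w.
  have [|l xyl] := @gdist_lt x y (Num.min m e); first by rewrite lt_min dm.
  rewrite lt_min => /andP[lm le]; have [el|[w [/mP mw cw]]] := alt l xyl; lra.
have [[u xu]|[u [v [t [uv /andP[t0 t1] xt]]]]] := point_rep x.
  exists (c u); last by move=> w; rewrite xu => /vtx_supp ->.
  by apply: dc; rewrite xu /= vtxE eqxx.
exists (Num.min (c u) (c v)); last first.
  by move=> w; rewrite xt => /seg_supp[]->; rewrite ge_min lexx ?orbT.
by rewrite lt_min !dc// xt ?segl ?segr//; lra.
Qed.

Lemma gdist_vertex_le x w v : 0 < x w ->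
  gdist x (vpt v) <= 1 - x w + (vdist w v)%:R.
Proof.
move=> xw; apply: le_trans (gdist_tri (vpt w) _ _) _; apply: lerD.
  exact: gdist_supp.
have [p [wp <- <-]] := vdist_path w v.
by apply: gdist_le; apply: path_length_vertex.
Qed.

(** The infimum over paths is a minimum over the support, so that distances to a vertex are
    expressed by [vdist]. *)
Lemma gdist_vertex x v :
  exists w, 0 < x w /\ gdist x (vpt v) = 1 - x w + (vdist w v)%:R.
Proof.
(* Paths to a vertex always give the second alternative, so [e] can be any number exceeding the
   distance. *)
have [] := @ge_gdist_alt x (vpt v) (gdist x (vpt v) + 1)
    (fun w => 1 - x w + (vdist w v)%:R).
- by move=> l /path_length_to_vertex; right.
- by move=> h; exfalso; lra.
move=> [w [xw wd]]; exists w; split=> //.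
by apply/eqP; rewrite eq_le wd gdist_vertex_le.
Qed.

Lemma gdist_vpt u v : gdist (vpt u) (vpt v) = (vdist u v)%:R.
Proof.
have [w [/= /vtx_supp -> ->]] := gdist_vertex (vpt u) v.
by rewrite vtxE eqxx subrr add0r.
Qed.

Lemma gdist_adj_le a b y : adj a b -> gdist (vpt a) y <= 1 + gdist (vpt b) y.
Proof.
move=> ab; apply: le_trans (gdist_tri (vpt b) _ _) _.
by rewrite lerD2r gdist_vpt (ler_nat _ _ 1) vdist_adj.
Qed.

Lemma gdist_supp_le x w y : 0 < x w -> gdist x y <= 1 - x w + gdist (vpt w) y.
Proof.
by move=> /gdist_supp xw; apply: le_trans (gdist_tri (vpt w) _ _) _; rewrite lerD2r.
Qed.

Lemma seg_inj a b u v t s : adj a b -> adj u v -> 0 < t < 1 ->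
  seg a b t = seg u v s -> (a = u /\ b = v /\ s = t) \/
  (a = v /\ b = u /\ s = 1 - t).
Proof.
move=> ab uv /andP[t0 t1] E.
have ha : seg u v s a = 1 - t by rewrite -E segl.
have hb : seg u v s b = t by rewrite -E segr.
have [au|av] : a = u \/ a = v by apply: (@seg_supp u v s); rewrite ha; lra.
- left; subst a; have [bu|bv] : b = u \/ b = v.
    by apply: (@seg_supp u v s); rewrite hb.
  - by subst b; rewrite adj_irr in ab.
  by subst b; move: hb; rewrite segr.
- right; subst a; have [bu|bv] : b = u \/ b = v.
    by apply: (@seg_supp u v s); rewrite hb.
  - by subst b; move: ha; rewrite segr.
  by subst b; rewrite adj_irr in ab.
Qed.

(** A path either stays in one edge or at some time leaves the edge of x through an end w. What
    follows w is measured by [gdist], which is enough for the later passage to the infimum. *)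
Lemma path_length_alt x y l : path_length x y l ->
  (exists u v s t, [/\ adj u v, 0 <= s <= 1 /\ 0 <= t <= 1,
     coord x = seg u v s, coord y = seg u v t & `|s - t| <= l]) \/
  exists w, 0 < x w /\ 1 - x w + gdist (vpt w) y <= l.
Proof.
elim=> {x y l}[x|x z y a b s t l ab s01 t01 xs zt zyl IH].
  have [[u ->]|[u [v [t [uv t01 xt]]]]] := point_rep x.
    by right; exists u; rewrite /= vtxE eqxx subrr add0r gdistxx ltr01.
  left; exists u, v, t, t; rewrite subrr normr0.
  by case/andP: t01 => /ltW-> /ltW->.
have [s0 s1] := andP s01; have [t0 t1] := andP t01.
have st : s - t <= `|s - t| /\ t - s <= `|s - t|.
  by rewrite ler_norm distrC ler_norm.
(* The induction hypothesis is transferred to the edge ab of the move: an interior point z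
   determines its edge up to orientation, and if z is an end of ab the path leaves through that
   vertex. *)
have {}IH : (0 < t < 1 /\ exists t', [/\ 0 <= t' <= 1, coord y = seg a b t'
    & `|t - t'| <= l]) \/ exists w, 0 < z w /\ 1 - z w + gdist (vpt w) y <= l.
  have [t_gt0|t_le0] := ltP 0 t; last first.
    right; exists a; rewrite zt segl//; split; first by lra.
    suff <- : z = vpt a by have := gdist_le zyl; lra.
    by apply: coord1; rewrite zt segl//; lra.
  have [t_lt1|t_ge1] := ltP t 1; last first.
    right; exists b; rewrite zt segr//; split; first by lra.
    suff <- : z = vpt b by have := gdist_le zyl; lra.
    by apply: coord1; rewrite zt segr//; lra.
  have [[u [v [s' [t' [uv [s'01 t'01] zs' yt' stl]]]]]|] := IH; last by right.
  left; split=> //; have zz : seg a b t = seg u v s' by rewrite -zt.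
  have [|[-> [-> <-]]|[-> [-> E]]] := seg_inj ab uv _ zz; first exact/andP.
    by exists t'.
  exists (1 - t'); rewrite -segC; split=> //; first by case/andP: t'01 => *; lra.
  by move: stl; rewrite E -normrN; congr (`|_| <= _); ring.
case: IH => [[_ [t' [t'01 yt' tt']]]|[w [zw wl]]].
  left; exists a, b, s, t'; split=> //.
  by rewrite (le_trans (ler_distD t _ _))// lerD2l.
have dab := gdist_adj_le y ab; have ba : adj b a by rewrite adj_sym.
have dba := gdist_adj_le y ba.
right; move: zw wl; rewrite zt => /[dup] /seg_supp[]->; rewrite ?segl ?segr// => _ wl.
  have [s_lt1|s_ge1] := ltP s 1; [exists a|exists b]; rewrite xs ?segl ?segr//; lra.
have [s_gt0|s_le0] := ltP 0 s; [exists b|exists a]; rewrite xs ?segl ?segr//; lra.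
Qed.

Lemma gdist_cases x y :
  (exists u v s t, [/\ adj u v, 0 <= s <= 1 /\ 0 <= t <= 1,
     coord x = seg u v s, coord y = seg u v t & gdist x y = `|s - t|]) \/
  exists w, 0 < x w /\ gdist x y = 1 - x w + gdist (vpt w) y.
Proof.
set edge := (X in X \/ _); have [//|nedge] := pselect edge; [by left|right].
suff [w [xw wd]] : exists w, 0 < x w /\ 1 - x w + gdist (vpt w) y <= gdist x y.
  by exists w; split=> //; apply/eqP; rewrite eq_le gdist_supp_le.
have [[u [v [s [t [uv [s01 t01] xs yt]]]]]|nce] := pselect
    (exists u v s t, [/\ adj u v, 0 <= s <= 1 /\ 0 <= t <= 1,
     coord x = seg u v s & coord y = seg u v t]); last first.
  have [l /path_length_alt|h|//] := @ge_gdist_alt x y (gdist x y + 1)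
      (fun w => 1 - x w + gdist (vpt w) y); last by lra.
  case=> [[u [v [s [t [uv st xs yt _]]]]]|]; last by right.
  by case: nce; exists u, v, s, t.
have [l /path_length_alt|h|//] := @ge_gdist_alt x y `|s - t|
    (fun w => 1 - x w + gdist (vpt w) y); last first.
  case: nedge; exists u, v, s, t; split=> //; apply/eqP; rewrite eq_le h.
  by rewrite (gdist_edge uv).
case=> [[u' [v' [s' [t' [uv' st' xs' yt' sl]]]]]|]; [left|by right].
(* The edge in which the path runs may be another one, or the same one reversed. The coordinate at u
   allows the comparison: between x and y it varies by [|s - t|] on uv, and by at most [|s' - t'|]
   on any edge containing both. *)
have -> : `|s - t| = `|x u - y u|.
  by rewrite xs yt !segl// distrC; congr (`|_|); ring.
suff : `|x u - y u| <= `|s' - t'| by move/le_trans; apply.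
rewrite xs' yt' !segE.
have [uu|_] := eqVneq u u'; have [uw|_] := eqVneq u v'.
- by move: uv'; rewrite -uu -uw adj_irr.
- rewrite /= !mulr1 !mulr0 !addr0 (_ : 1 - s' - (1 - t') = - (s' - t')) ?normrN//.
  by ring.
- by rewrite /= !mulr1 !mulr0 !add0r.
- by rewrite /= !mulr0 addr0 subrr normr0.
Qed.

End Metric.

(** * Geodesic triangles and hyperbolicity constants *)

Section MetricTriangles.
Variables (R : realType) (X : Type) (d : X -> X -> R).
Hypotheses (d_ge0 : forall x y, 0 <= d x y) (dxx : forall x, d x x = 0)
  (dC : forall x y, d x y = d y x).
Implicit Types (x y z p q : X) (A B C : set X).

Lemma geodesicC x y A : geodesic d x y A -> geodesic d y x A.
Proof.
move=> [g [g0 g1 gd ->]]; exists (fun t => g (d x y - t)); split.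
- by rewrite subr0.
- by rewrite dC subrr.
- move=> s t; rewrite dC => s01 t01; rewrite gd//; try lra.
  by rewrite -normrN; congr (`|_|); ring.
apply/seteqP; split=> q [t /=]; rewrite ?[d y x]dC => /andP[t0 t1] <-.
  by exists (d x y - t); rewrite /= ?subKr//; lra.
by exists (d x y - t) => //=; lra.
Qed.

Lemma geodesic_refl x : geodesic d x x [set x].
Proof.
exists (fun=> x); rewrite dxx; split=> // [s t s0 t0|].
  have [-> ->] : s = 0 /\ t = 0 by split; lra.
  by rewrite subrr normr0.
apply/seteqP; split=> q /= => [->|[t _ <-//]].
by exists 0 => //=; rewrite lexx.
Qed.

Lemma geodesic_start x y A : geodesic d x y A -> A x.
Proof. by move=> [g [<- _ _ ->]]; exists 0; rewrite //= lexx d_ge0. Qed.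

Lemma dist_to_set_le p q A : A q -> dist_to_set d p A <= d p q.
Proof.
by move=> Aq; apply: ge_inf; [exists 0 => _ [a _ <-]|exists q].
Qed.

Lemma le_dist_to_set p q A c : A q -> (forall a, A a -> c <= d p a) ->
  c <= dist_to_set d p A.
Proof.
move=> Aq Ac; apply: lb_le_inf; first by exists (d p q), q.
by move=> _ [a /Ac ca <-].
Qed.

(** Rotating the triangle brings any side to the first place, so a far point is sought on [xy] only.
    The strict inequality c < e is the slack spent in the applications. *)
Lemma delta_space_le c : 0 <= c ->
  (forall x y z A B C p e, c < e -> geodesic d x y A -> geodesic d y z B ->
     geodesic d z x C -> A p -> (forall q, (B `|` C) q -> e <= d p q) -> False) ->
  (delta_space d <= c%:E)%E.
Proof.
move=> c0 far.
have side x y z A B C p : geodesic d x y A -> geodesic d y z B ->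
    geodesic d z x C -> A p -> dist_to_set d p (B `|` C) <= c.
  move=> xy yz zx Ap; rewrite leNgt; apply/negP => cd.
  apply: far cd xy yz zx Ap _ => q; exact: dist_to_set_le.
apply: ge_ereal_sup => _ [A [B [C [[x [y [z [xy yz zx]]]] ->]]]].
apply: ereal_inf_lbound; exists c => //=; split=> //.
by split=> p ?; [apply: side xy yz zx _|apply: side yz zx xy _|
  apply: side zx xy yz _].
Qed.

Lemma delta_space_ge x y z A B C p c : geodesic d x y A -> geodesic d y z B ->
  geodesic d z x C -> A p -> (forall q, (B `|` C) q -> c <= d p q) ->
  (c%:E <= delta_space d)%E.
Proof.
move=> xy yz zx Ap far; apply: le_ereal_sup_tmp; exists (delta_triangle d A B C).
  by exists A, B, C; split=> //; exists x, y, z.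
apply: le_ereal_inf_tmp => _ [e [_ [/(_ p Ap) eA _ _]] <-]; rewrite lee_fin.
apply: le_trans eA; apply: le_dist_to_set far; left.
exact: geodesic_start yz.
Qed.

End MetricTriangles.

Section Isometry.
Variables (R : realType) (X Y : Type) (dX : X -> X -> R) (dY : Y -> Y -> R).
Variable f : X -> Y.
Hypothesis fd : forall x y, dY (f x) (f y) = dX x y.

Lemma geodesic_isometry x y A :
  geodesic dX x y A -> geodesic dY (f x) (f y) (f @` A).
Proof.
move=> [h [h0 h1 hd ->]]; exists (f \o h); rewrite fd /= h0 h1; split=> //.
  by move=> s t s01 t01; rewrite fd hd.
by rewrite image_comp.
Qed.

Lemma dist_to_set_isometry x A : dist_to_set dY (f x) (f @` A) = dist_to_set dX x A.
Proof.
congr inf; apply/seteqP; split=> r /=.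
  by move=> [_ [a Aa <-] <-]; exists a; rewrite ?fd.
by move=> [a Aa <-]; exists (f a); rewrite ?fd//; exists a.
Qed.

Lemma thin_isometry e A B C : thin dY e (f @` A) (f @` B) (f @` C) -> thin dX e A B C.
Proof.
move=> [eA eB eC]; split=> p Ap; rewrite -dist_to_set_isometry image_setU.
- by apply: eA; exists p.
- by apply: eB; exists p.
- by apply: eC; exists p.
Qed.

Lemma delta_space_isometry_le : (delta_space dX <= delta_space dY)%E.
Proof.
apply: ge_ereal_sup => _ [A [B [C [[x [y [z [xy yz zx]]]] ->]]]].
apply: le_ereal_sup_tmp; exists (delta_triangle dY (f @` A) (f @` B) (f @` C)).
  exists (f @` A), (f @` B), (f @` C); split=> //.
  by exists (f x), (f y), (f z); split; apply: geodesic_isometry.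
apply: le_ereal_inf_tmp => _ [e [e0 /thin_isometry eABC] <-].
by apply: ereal_inf_lbound; exists e.
Qed.

End Isometry.

(** * Crossing from one set of vertices to another *)

Section Lipschitz.
Variables (R : realType) (G : graph).
Implicit Types (u v w : G) (x y z p q : point R G) (S : pred G).

Lemma lin_subproof x : exists r : G * G * R, coord x = seg r.1.1 r.1.2 r.2.
Proof.
have [[u ->]|[u [v [t [_ _ ->]]]]] := point_rep x; last by exists (u, v, t).
by exists (u, u, 0); rewrite seg0.
Qed.

(* The chosen representation is irrelevant, see [lin_seg]. *)
Definition lin (phi : G -> R) x : R :=
  let r := projT1 (cid (lin_subproof x)) in
  (1 - r.2) * phi r.1.1 + r.2 * phi r.1.2.

(** The vertex set may be infinite, so the sum runs over a finite list containing the ends. Its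
    left-hand side depends only on the coordinate function, hence two representations of a point
    give the same value of [lin]. *)
Lemma sum_seg (phi : G -> R) (s : seq G) u v (t : R) : uniq s -> u \in s -> v \in s ->
  \sum_(w <- s) seg u v t w * phi w = (1 - t) * phi u + t * phi v.
Proof.
have sum_vtx u' : uniq s -> u' \in s -> \sum_(w <- s) vtx R u' w * phi w = phi u'.
  move=> us u's; rewrite (bigD1_seq u')//= /vtx eqxx mul1r big1 ?addr0// => w.
  by move=> /negPf ->; rewrite mul0r.
move=> us su sv; rewrite -(sum_vtx u)// -(sum_vtx v)// !mulr_sumr -big_split.
by apply: eq_bigr => w _; rewrite /seg mulrDl !mulrA.
Qed.

Lemma lin_seg phi x u v (t : R) :
  coord x = seg u v t -> lin phi x = (1 - t) * phi u + t * phi v.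
Proof.
rewrite /lin; case: cid => [[[u' v'] t']] /= -> E.
have us := undup_uniq [:: u; v; u'; v'].
by rewrite -!(sum_seg _ _ us) ?mem_undup ?inE ?eqxx ?orbT// E.
Qed.

Definition mass S := lin (fun w => (S w)%:R).

Lemma mass_vpt S u : mass S (vpt R u) = (S u)%:R.
Proof. by rewrite /mass (@lin_seg _ _ u u 0) ?seg0// subr0 mul1r mul0r addr0. Qed.

Lemma mass_seg S x u v (t : R) :
  coord x = seg u v t -> mass S x = (1 - t) * (S u)%:R + t * (S v)%:R.
Proof. exact: lin_seg. Qed.

Lemma mass_lip S x y : `|mass S x - mass S y| <= gdist x y.
Proof.
apply: le_gdist => l; elim=> {x y l}[x|x z y a b s t l ab s01 t01 xs zt _ IH].
  by rewrite subrr normr0.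
rewrite (le_trans (ler_distD (mass S z) _ _))// lerD// (mass_seg _ xs) (mass_seg _ zt).
rewrite (_ : _ - _ = (t - s) * ((S a)%:R - (S b)%:R)); last first.
  by move: (S a)%:R (S b)%:R => ? ?; ring.
rewrite normrM [`|s - t|]distrC ler_piMr//.
by case: (S a); case: (S b); rewrite ?subrr ?subr0 ?sub0r ?normrN1 ?normr0 ?normr1.
Qed.

Lemma mass1 S x : (forall w, 0 < x w -> S w) -> mass S x = 1.
Proof.
have [[u ->]|[u [v [t [uv /andP[t0 t1] xt]]]]] := point_rep x => xS.
  by rewrite mass_vpt xS//= vtxE eqxx.
by rewrite (mass_seg _ xt) !xS ?xt ?segl ?segr ?subr_gt0//= !mulr1 subrK.
Qed.

Lemma mass_lt1 S x w : 0 < x w -> ~~ S w -> mass S x < 1.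
Proof.
move=> /supp_rep[->|[v [t [wv /andP[t0 t1] xt]]]] /negPf nS.
  by rewrite mass_vpt nS.
by rewrite (mass_seg _ xt) nS; case: (S v) => /=; lra.
Qed.

(** F is sampled on a grid of mesh h < e. At the first sample with F < 1 the previous one is at
    least 1, so F has lost at most h in between. *)
Lemma first_drop (F : R -> R) (l e : R) : 0 < e -> 0 <= l ->
  (forall s t, 0 <= s <= l -> 0 <= t <= l -> `|F s - F t| <= `|s - t|) ->
  F 0 = 1 -> F l < 1 -> exists2 t, 0 <= t <= l & 1 - e <= F t < 1.
Proof.
move=> e0 l0 FL F0 Fl; have {l0} l0 : 0 < l.
  by rewrite lt_neqAle l0 andbT; apply: contraTneq Fl => <-; rewrite F0 ltxx.
pose n := (Num.bound (l / e)).+1; pose h := l / n%:R.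
have n0 : 0 < n%:R :> R by rewrite ltr0n.
have le_n : l / e < n%:R.
  rewrite (lt_trans (archi_boundP _)) ?ltr_nat ?leqnn// divr_ge0//; lra.
have h0 : 0 < h by rewrite divr_gt0.
have he : h < e by rewrite ltr_pdivrMr// mulrC -ltr_pdivrMr.
have nh : n%:R * h = l by rewrite /h mulrC divfK// gt_eqF.
have ex : exists k, (k <= n)%N && (F (k%:R * h) < 1).
  by exists n; rewrite leqnn nh.
have kl k : (k <= n)%N -> 0 <= k%:R * h <= l.
  by move=> kn; rewrite mulr_ge0 ?(ltW h0)//= -nh ler_pM2r// ler_nat.
case: (ex_minnP ex) => -[|k] /andP[kn Fk] kmin.
  by move: Fk; rewrite mul0r F0 ltxx.
have Fk' : 1 <= F (k%:R * h).
  rewrite leNgt; apply/negP => Fk'; have := kmin k.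
  by rewrite Fk' (ltnW kn) ltnn => /(_ isT).
exists (k.+1%:R * h); first exact: kl.
rewrite Fk andbT; have := FL _ _ (kl _ (ltnW kn)) (kl _ kn).
rewrite -natr1 mulrDl mul1r opprD addNKr normrN (gtr0_norm h0) => Fd.
have := ler_norm (F (k%:R * h) - F (k%:R * h + h)); lra.
Qed.

(* The mass on S is 1-Lipschitz, so it comes close to 1 without reaching it;
   this happens only near the end in S of an edge leaving S. *)
Lemma crossing1 S x z A e : 0 < e -> geodesic (@gdist R G) x z A ->
  (forall w, 0 < x w -> S w) -> (exists2 w, 0 < z w & ~~ S w) ->
  exists q w w', [/\ A q, S w, ~~ S w', adj w w' & gdist q (vpt R w) <= e].
Proof.
move=> e0 [g [g0 g1 gd ->]] xS [w zw nSw].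
pose F t := mass S (g t).
(* The bound 1/2 keeps the mass positive, which discards points without support in S; the bound e
   makes [g t] lie within e of the end in S. *)
have [|||||t t01 /andP[Ft Ft1]] := @first_drop F (gdist x z) (Num.min e 2^-1).
- by rewrite lt_min e0; lra.
- exact: gdist_ge0.
- by move=> s t s01 t01; rewrite -(gd s t)// mass_lip.
- by rewrite /F g0 mass1.
- by rewrite /F g1 (mass_lt1 zw).
have [ee e2] : 1 - e <= F t /\ 1 - 2^-1 <= F t.
  by move: Ft; rewrite lerBlDr -lerBlDl le_min => /andP[]; lra.
have Aq : [set g t | t in [set t | 0 <= t <= gdist x z]] (g t) by exists t.
have [[u gu]|[u [v [s [uv /andP[s0 s1] gs]]]]] := point_rep (g t).
  by move: Ft1 e2; rewrite /F gu mass_vpt; case: (S u) => /=; lra.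
move: Ft1 ee e2; rewrite /F (mass_seg _ gs); case Su: (S u); case Sv: (S v) => /= m1 me m2.
- by exfalso; lra.
- exists (g t), u, v; rewrite Su Sv; split=> //.
  have gu : 0 < g t u by rewrite gs segl// subr_gt0.
  by apply: le_trans (gdist_supp gu) _; rewrite gs segl//; lra.
- exists (g t), v, u; rewrite Su Sv adj_sym; split=> //.
  have gv : 0 < g t v by rewrite gs segr.
  by apply: le_trans (gdist_supp gv) _; rewrite gs segr//; lra.
- by exfalso; lra.
Qed.

Lemma crossing S x z y A B e : 0 < e -> geodesic (@gdist R G) x z A ->
  geodesic (@gdist R G) z y B ->
  (forall w, 0 < x w -> S w) -> (forall w, 0 < y w -> ~~ S w) ->
  exists q w w', [/\ (A `|` B) q, S w, ~~ S w', adj w w' & gdist q (vpt R w) <= e].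
Proof.
move=> e0 xz zy xS yS.
have [zS|nzS] := pselect (forall w, 0 < z w -> S w).
  have [u yu] := exists_supp y.
  have [|q [w [w' [Bq Sw Sw' ww' qw]]]] := crossing1 e0 zy zS.
    by exists u => //; apply: yS.
  by exists q, w, w'; split=> //; right.
have [|q [w [w' [Aq Sw Sw' ww' qw]]]] := crossing1 e0 xz xS.
  apply: contrapT => nex; apply: nzS => w zw; apply: contrapT => /negP nSw.
  by apply: nex; exists w.
by exists q, w, w'; split=> //; left.
Qed.

End Lipschitz.

(** * Steps along geodesics *)

Section Steps.
Variables (R : realType) (G : graph).
Implicit Types (u v w : G) (x y z p q : point R G).
Local Notation vpt := (@vpt R G).
Local Notation d := (@gdist R G).

Lemma step_toward x u : 1 <= d x (vpt u) ->
  exists w, adj u w /\ d x (vpt w) = d x (vpt u) - 1.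
Proof.
have [w0 [xw0 E]] := gdist_vertex x u; rewrite E => h.
case D: (vdist w0 u) h E => [|n] h E; first by lra.
have [w uw wn] : exists2 w, adj u w & vdist w w0 = n by apply: vdistS; rewrite vdistC.
exists w; split=> //; have := gdist_adj_le x uw; rewrite ![d (vpt _) x]gdistC.
have := gdist_vertex_le w xw0; rewrite vdistC wn; rewrite E -natr1; lra.
Qed.

(** The absolute value covers two cases. From distance 1 on, w is a step towards x. Below 1, x lies
    on an edge at u, whose other end is w; if x is u itself, any neighbour will do. *)
Lemma neighbor_toward x u : ~ trivial_graph G ->
  exists w, adj u w /\ d x (vpt w) <= `|d x (vpt u) - 1|.
Proof.
move=> ntG; have [/step_toward[w [uw E]]|d1] := leP 1 (d x (vpt u)).
  by exists w; split=> //; rewrite E ler_norm.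
have [w [xw E]] := gdist_vertex x u.
case D: (vdist w u) E => [|n] E; last first.
  by have := coord_le1 x w; have := ler0n R n; rewrite E -natr1 in d1; lra.
move/vdist0: D => D; subst w; have [xu|[v [t [uv /andP[t0 t1] xt]]]] := supp_rep xw.
  have [v uv] := exists_adj ntG u; exists v; split=> //.
  rewrite xu !gdist_vpt vdistxx sub0r normrN1 (ler_nat _ _ 1).
  exact: vdist_adj.
exists v; split=> //; have xv : 0 < x v by rewrite xt segr.
apply: le_trans (gdist_supp xv) _; rewrite E xt segl// segr// ler_normr.
by apply/orP; right; lra.
Qed.

Lemma gdist_far x p : 1 < d x p ->
  exists w, 0 < p w /\ d x p = d x (vpt w) + (1 - p w).
Proof.
move=> d1; have [[u [v [s [t [uv [s01 t01] xs pt E]]]]]|[w [pw E]]] := gdist_cases p x.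
  exfalso; move: d1; rewrite gdistC E; apply/negP; rewrite -leNgt ler_norml.
  by case/andP: s01; case/andP: t01 => *; apply/andP; split; lra.
by exists w; split=> //; rewrite gdistC E addrC gdistC.
Qed.

(** As x and y are more than 1 away, shortest routes from p to them leave the edge of p through its
    ends, and using the same end twice would give a shortcut from x to y. If p is a vertex, then t =
    0 and v is a step towards y. *)
Lemma geodesic_edge x y p : d x p + d p y = d x y -> 1 < d x p -> 1 < d p y ->
  exists u v (t : R), [/\ adj u v, 0 <= t <= 1,
    d p (vpt u) <= t /\ d p (vpt v) <= 1 - t,
    d x p = d x (vpt u) + t & d p y = 1 - t + d (vpt v) y].
Proof.
move=> E xp py.
have [u [pu Eu]] := gdist_far xp.
have [v [pv Ev]] : exists w, 0 < p w /\ d p y = d (vpt w) y + (1 - p w).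
  have [|v [pv Ev]] := @gdist_far y p; first by rewrite gdistC.
  by exists v; rewrite gdistC Ev [d y _]gdistC.
have vertex w : p = vpt w -> exists u v (t : R), [/\ adj u v, 0 <= t <= 1,
    d p (vpt u) <= t /\ d p (vpt v) <= 1 - t,
    d x p = d x (vpt u) + t & d p y = 1 - t + d (vpt v) y].
  move=> pE; have [|w' [ww' E']] := @step_toward y w; first by rewrite -pE gdistC; lra.
  exists w, w', 0; rewrite lexx ler01 pE gdistxx addr0 subr0; split=> //.
    by split=> //; rewrite gdist_vpt (ler_nat _ _ 1) vdist_adj.
  by rewrite gdistC [d (vpt w') y]gdistC E'; ring.
have [/vertex//|[v' [t [uv' t01 pt]]]] := supp_rep pu.
have [t0 t1] := andP t01; have pv' : 0 < p v' by rewrite pt segr.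
have [uv|uv] := eqVneq v u.
  subst v; have := gdist_tri (vpt u) x y; move: Eu Ev; rewrite pt segl//; lra.
have ? : v = v' by move: pv; rewrite pt => /seg_supp[uv0|//]; rewrite uv0 eqxx in uv.
subst v'; exists u, v, t; split=> //; first by rewrite !ltW.
- by have := gdist_supp pu; have := gdist_supp pv; rewrite pt segl// segr//; split; lra.
- by rewrite Eu pt segl//; ring.
- by rewrite Ev pt segr//; ring.
Qed.

(** The vertex u is the end of the edge of p nearer to p, hence within 1/2 of it; the bound 3/2
    leaves more than 1 beyond u, which is room for one further step. *)
Lemma geodesic_interior x y p : d x p + d p y = d x y ->
  3 / 2 < d x p -> 3 / 2 < d p y ->
  exists w1 u w2, [/\ adj w1 u, adj u w2, d p (vpt u) <= 1 / 2 &
    d x y = d x (vpt w1) + 2 + d (vpt w2) y].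
Proof.
move=> E xp py.
have [||u [v [t [uv /andP[t0 t1] [pu pv] Eu Ev]]]] := geodesic_edge E; try lra.
have [t2|t2] := leP t (1 / 2).
  have [|w [uw wE]] := @step_toward x u; first lra.
  exists w, u, v; split=> //; first by rewrite adj_sym.
    exact: le_trans pu t2.
  by rewrite wE -E Eu Ev; lra.
have [|w [vw wE]] := @step_toward y v; first by rewrite gdistC; lra.
exists u, v, w; split=> //; first by lra.
by rewrite -E Eu Ev [d (vpt w) y]gdistC wE [d y _]gdistC; lra.
Qed.

Lemma geodesic_between x y A p : geodesic d x y A -> A p -> d x p + d p y = d x y.
Proof.
move=> [g [g0 g1 gd ->]] [t /= t01 <-].
have [t0 t1] := andP t01; have d0 := gdist_ge0 x y.
rewrite -[in d x _]g0 -[in d _ y]g1 !gd ?lexx ?d0//.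
by rewrite sub0r normrN ger0_norm// distrC ger0_norm ?subr_ge0//; lra.
Qed.

End Steps.

(** * Upper bound *)

(** S is the component of a once the edge ab is removed. A simple path from a to b avoiding this
    edge would close up to a cycle with at least three vertices. *)
Lemma tree_bridge (T : graph) (a b : T) : tree T -> adj a b ->
  exists S : pred T, [/\ S a, ~~ S b &
    forall u v, adj u v -> S u -> ~~ S v -> u = a /\ v = b].
Proof.
move=> treeT ab.
pose e u v := adj u v && ~~ ((u == a) && (v == b) || (u == b) && (v == a)).
pose S u := `[< exists2 p, path e a p & last a p = u >].
have Sa : S a by apply/asboolP; exists [::].
have nSb : ~~ S b.
  apply/negP => /asboolP[p /shortenP[{}p ap up _] pb].
  have : (size (a :: p) < 3)%N.
    apply: treeT; rewrite /ucycle up andbT /= rcons_path pb adj_sym ab andbT.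
    by apply: sub_path ap => u v /andP[].
  case: p ap pb {up} => [_ /= ba|c [|//] /= /andP[/andP[_ ac] _] cb].
    by rewrite ba adj_irr in ab.
  by move: ac; rewrite cb !eqxx.
exists S; split=> // u v uv /asboolP[p ap pu] nSv.
have [/= /orP[]/andP[/eqP ua /eqP vb]//|nuv] :=
    boolP ((u == a) && (v == b) || (u == b) && (v == a)).
  by case/negP: nSb; rewrite -ua; apply/asboolP; exists p.
case/negP: nSv; apply/asboolP; exists (rcons p v); last by rewrite last_rcons.
by rewrite rcons_path ap pu /e uv.
Qed.

Section LexicographicDistance.
Variables G1 G2 : graph.
Local Notation H := (lex_product G1 G2).
Implicit Types v w : H.

Lemma adj_lexE v w : adj v w = adj v.1 w.1 || (v.1 == w.1) && adj v.2 w.2.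
Proof. by []. Qed.

Lemma adj_fst v w : adj v.1 w.1 -> adj v w.
Proof. by rewrite adj_lexE => ->. Qed.

Lemma adj_lex_cases v w : adj v w -> v.1 = w.1 \/ adj v.1 w.1.
Proof. by rewrite adj_lexE => /orP[|/andP[/eqP ? _]]; [right|left]. Qed.

Lemma vdist_fibre v w : ~ trivial_graph G1 -> v.1 = w.1 -> (vdist v w <= 2)%N.
Proof.
move=> nt1 vw; have [u vu] := exists_adj nt1 v.1.
apply: (@vdist_le2 H v w (u, v.2)); apply: adj_fst => //=.
by rewrite -vw adj_sym.
Qed.

Lemma vdist_fst v w : (vdist v.1 w.1 <= vdist v w)%N.
Proof.
elim: {v}(vdist v w) {-2}v (erefl (vdist v w)) => [|n IHn] u uw; rewrite uw.
  by rewrite (vdist0 uw) vdistxx.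
have [u' uu' /[dup] u'w /IHn n'] := vdistS uw; rewrite u'w in n'.
have [->|/vdist_adj u1] := adj_lex_cases uu'; first by rewrite leqW.
exact: leq_trans (vdist_tri _ u'.1 _) (leq_add u1 n').
Qed.

End LexicographicDistance.

Section UpperBound.
Variables (R : realType) (G1 G2 : graph).
Hypotheses (treeG1 : tree G1) (ntG1 : ~ trivial_graph G1).
Local Notation H := (lex_product G1 G2).
Local Notation d := (@gdist R H).
Local Notation vpt := (@vpt R H).

Lemma lex_nontrivial : ~ trivial_graph H.
Proof.
move=> [v vE]; have [u vu] := exists_adj ntG1 v.1.
by have /(congr1 fst)/= uv := vE (u, v.2); rewrite uv adj_irr in vu.
Qed.

(** The neighbour w3 of w1 towards x is within 2 of w2. Hence d(x,w1) + 2 is at most |d(x,w1) - 1| +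
    2, which forces d(x,w1) to be at most 1/2. *)
Lemma fibre_step (x : point R H) (w1 w2 : H) : w1.1 = w2.1 ->
  d x (vpt w1) + 2 <= d x (vpt w2) -> d x (vpt w1) <= 1 / 2.
Proof.
move=> w12 xw; have [w3 [w13 xw3]] := neighbor_toward x w1 lex_nontrivial.
have w32 : (vdist w3 w2 <= 2)%N.
  have [w13'|w13'] := adj_lex_cases w13.
    by apply: vdist_fibre; rewrite // -w13'.
  rewrite (leq_trans (vdist_adj _))//; apply: adj_fst.
  by rewrite adj_sym -w12.
have := gdist_tri (vpt w3) x (vpt w2); rewrite gdist_vpt.
move: w32; rewrite -(ler_nat R) => w32.
by move: xw3; case: ger0P; lra.
Qed.

Lemma far_support (x : point R H) (w w1 w2 : H) :
  d x (vpt w1) + 2 <= d x (vpt w2) -> 0 < x w -> (vdist w w1 < vdist w w2)%N.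
Proof.
move=> xw12 xw; rewrite ltnNge -(ler_nat R); apply/negP => w12.
have := gdist_vertex_le w2 xw; have := gdist_supp xw.
by have := gdist_tri x (vpt w) (vpt w1); rewrite gdist_vpt [d (vpt w) x]gdistC; lra.
Qed.

(* If the point p of [xy] is more than 3/2 away from x and y, it is within 1/2
   of a vertex u lying between w1 and w2 on a geodesic.  If w1 and w2 are in the
   same fibre, x and y are at distance at most 3; otherwise the projection of w1
   to u is a bridge of the tree, so that the other two sides pass through the
   fibre of w1, every vertex of which is adjacent to u. *)
Lemma hyp_const_lex_le : (hyp_const R H <= (3 / 2 : R)%:E)%E.
Proof.
apply: delta_space_le => [||x y z A B C p e e32 xy yz zx Ap far].
- exact: gdist_ge0.
- by lra.
have dC := @gdistC R H; have d0 := @gdist_ge0 R H.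
have yB : e <= d p y by apply: far; left; apply: geodesic_start yz.
have xC : e <= d p x.
  by apply: far; right; apply: geodesic_start (geodesicC _ zx).
have [||w1 [u [w2 [w1u uw2 pu E]]]] := geodesic_interior (geodesic_between xy Ap).
- by rewrite gdistC; lra.
- by lra.
have x12 : d x (vpt w1) + 2 <= d x (vpt w2) by have := gdist_tri (vpt w2) x y; lra.
have y21 : d y (vpt w2) + 2 <= d y (vpt w1).
  by have := gdist_tri (vpt w1) x y; rewrite ![d y _]gdistC; lra.
have w12 : (2 <= vdist w1 w2)%N.
  by have := gdist_tri (vpt w1) x (vpt w2); rewrite gdist_vpt -(ler_nat R); lra.
have ac : w1.1 <> w2.1.
  move=> ac; have := fibre_step ac x12; have := fibre_step (esym ac) y21.
  have := geodesic_between xy Ap.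
  by rewrite [d y (vpt w2)]gdistC [d x p]gdistC; lra.
have nac : ~~ adj w1.1 w2.1.
  by apply: contraTN w12 => /adj_fst/vdist_adj; rewrite -ltnNge.
have ab : adj w1.1 u.1.
  have [w1E|//] := adj_lex_cases w1u; have [//|] := adj_lex_cases uw2.
    by rewrite -w1E => /ac.
  by rewrite -w1E (negPf nac).
have bc : adj u.1 w2.1.
  by have [uE|//] := adj_lex_cases uw2; rewrite -uE ab in nac.
have [S [Sa nSb Sab]] := tree_bridge treeG1 ab.
have nSc : ~~ S w2.1.
  by apply/negP => Sc; have [|/esym/ac] := Sab w2.1 u.1 _ Sc nSb; rewrite // adj_sym.
have Slex (v w : H) : adj v w -> S v.1 -> ~~ S w.1 -> v.1 = w1.1 /\ w.1 = u.1.
  move=> /adj_lex_cases[->|vw] Sv Sw; last exact: Sab.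
  by rewrite Sv in Sw.
(* A shortest path from outside S to w1 enters S from a vertex over [u.1], and every such vertex is
   adjacent to w2. *)
have left_side n v : vdist v w1 = n -> ~~ S v.1 -> (vdist v w2 <= n)%N.
  elim: n v => [|n IHn] v vn nSv; first by rewrite (vdist0 vn) Sa in nSv.
  have [v' vv' v'n] := vdistS vn; have [Sv'|nSv'] := boolP (S v'.1).
    have [|_ vE] := Slex _ _ _ Sv' nSv; first by rewrite adj_sym.
    by rewrite (leq_trans (vdist_adj _))//; apply: adj_fst; rewrite vE.
  apply: leq_trans (vdist_tri v v' w2) _; rewrite -add1n.
  by rewrite leq_add ?vdist_adj ?IHn.
(* Here the path leaves S from a vertex of the fibre of w1, within 2 of w1. The next vertex lies
   over [u.1] and so is not w2, which shows that at least two edges remained. *)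
have right_side n v : vdist v w2 = n -> S v.1 -> (vdist v w1 <= n)%N.
  elim: n v => [|n IHn] v vn Sv; first by rewrite (vdist0 vn) (negPf nSc) in Sv.
  have [v' vv' v'n] := vdistS vn; have [Sv'|nSv'] := boolP (S v'.1).
    apply: leq_trans (vdist_tri v v' w1) _; rewrite -add1n.
    by rewrite leq_add ?vdist_adj ?IHn.
  have [vE v'E] := Slex _ _ vv' Sv nSv'.
  rewrite (leq_trans (vdist_fibre ntG1 vE))// ltnS -v'n vdist_gt0//.
  by apply: contraTneq bc => v'w2; rewrite -v'E v'w2 adj_irr.
have xS w : 0 < x w -> S w.1.
  move=> /(far_support x12); apply: contraTT => nSw.
  by rewrite -leqNgt left_side.
have yS w : 0 < y w -> ~~ S w.1.
  move=> /(far_support y21); apply: contraTN => Sw.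
  by rewrite -leqNgt right_side.
(* The point q found below is within 1/2 + 1 + (e - 3/2)/2 of p, through u and w, and this is less
   than e. *)
have e1 : 0 < (e - 3 / 2) / 2 by lra.
have [q [w [w' [CBq Sw nSw' ww' qw]]]] := @crossing R H (fun w => S w.1) _ _ _ _ _
  _ e1 (geodesicC dC zx) (geodesicC dC yz) xS yS.
have [wE _] := Slex _ _ ww' Sw nSw'.
have : e <= d p q by apply: far; case: CBq; [right|left].
have uw : (vdist u w <= 1)%N by rewrite vdist_adj// adj_sym adj_fst// wE.
have := gdist_tri (vpt u) p q; have := gdist_tri (vpt w) (vpt u) q.
by rewrite gdist_vpt [d (vpt w) q]gdistC; move: uw; rewrite -(ler_nat R); lra.
Qed.

End UpperBound.

(** * Lower bounds *)

Section Walks.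
Variables (R : realType) (G : graph).
Implicit Types (u v w : G) (x y z p q : point R G) (t : R).
Local Notation vpt := (@vpt R G).
Local Notation d := (@gdist R G).

(* The junk value [vpt u] also serves the point 0 of a segment with no second
   vertex, as happens at the end of a walk. *)
Definition ept u v t : point R G :=
  if pselect (adj u v /\ 0 <= t <= 1) is left h
  then Point (is_point_seg h.1 h.2) else vpt u.

Lemma eptE u v t : adj u v -> 0 <= t <= 1 -> coord (ept u v t) = seg u v t.
Proof. by rewrite /ept; case: pselect => // h uv t01; case: h. Qed.

Lemma ept0 u v : ept u v 0 = vpt u.
Proof. by apply: point_eq; rewrite /ept; case: pselect => //= h; rewrite seg0. Qed.

Variables (a : G) (s : seq G).
Hypothesis walk : path (@adj G) a s.
Local Notation W := (nth a (a :: s)).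

Definition walk_pt t : point R G :=
  ept (W (Num.truncn t)) (W (Num.truncn t).+1) (t - (Num.truncn t)%:R).

Lemma walk_adj i : (i < size s)%N -> adj (W i) (W i.+1).
Proof. by move=> /(pathP a walk). Qed.

Lemma walk_ptE i t : (i < size s)%N -> 0 <= t <= 1 ->
  coord (walk_pt (i%:R + t)) = seg (W i) (W i.+1) t.
Proof.
move=> si /andP[t0]; rewrite le_eqVlt => /predU1P[->|t1].
  by rewrite natr1 /walk_pt natrK subrr ept0 seg1.
have iE : Num.truncn (i%:R + t) = i.
  by apply: truncn_def; rewrite lerDl t0 -natr1 ltrD2l.
by rewrite /walk_pt iE addrC addKr eptE ?walk_adj// t0 ltW.
Qed.

Lemma walk_ptP t : 0 <= t <= (size s)%:R -> (0 < size s)%N ->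
  exists i (r : R), [/\ (i < size s)%N, 0 <= r <= 1, t = i%:R + r &
    coord (walk_pt t) = seg (W i) (W i.+1) r].
Proof.
move=> /andP[t0 ts] s0; have [tlt|tge] := ltP t (size s)%:R.
  have /andP[ti it] := truncn_itv t0.
  have r01 : 0 <= t - (Num.truncn t)%:R <= 1.
    by move: it; rewrite -natr1; lra.
  have si : (Num.truncn t < size s)%N by rewrite -(ltr_nat R) (le_lt_trans ti).
  exists (Num.truncn t), (t - (Num.truncn t)%:R); split=> //; first by ring.
  by rewrite -walk_ptE//; congr (coord (walk_pt _)); ring.
have tE : t = (size s).-1%:R + 1 by rewrite natr1 prednK//; lra.
have sp : ((size s).-1 < size s)%N by rewrite prednK.
exists (size s).-1, 1; split=> //; first by rewrite ler01 lexx.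
by rewrite {1}tE walk_ptE// ler01 lexx.
Qed.

Lemma walk_pt_nat i : (i <= size s)%N -> (0 < size s)%N -> walk_pt i%:R = vpt (W i).
Proof.
move=> si s0; apply: point_eq; case: i si => [|i] si.
  by rewrite -[0%:R]addr0 walk_ptE ?lexx ?ler01// seg0.
by rewrite -natr1 walk_ptE ?ler01 ?lexx// seg1.
Qed.

Lemma walk_pt_mid i : (i < size s)%N ->
  coord (walk_pt (i%:R + 1 / 2)) = seg (W i) (W i.+1) (1 / 2).
Proof. by move=> si; rewrite walk_ptE//; lra. Qed.

Lemma walk_supp t w : 0 <= t <= (size s)%:R -> (0 < size s)%N ->
  0 < walk_pt t w -> w \in a :: s.
Proof.
move=> ts s0; have [i [r [si _ _ ->]]] := walk_ptP ts s0.
by move=> /seg_supp[]->; rewrite mem_nth//= ltnS// ltnW.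
Qed.

Lemma walk_vdist i k : (i + k <= size s)%N -> (vdist (W i) (W (i + k)) <= k)%N.
Proof.
elim: k => [|k IHk] sk; first by rewrite addn0 vdistxx.
rewrite addnS in sk *; rewrite -[k.+1]addn1.
by rewrite (leq_trans (vdist_tri _ (W (i + k)) _))// leq_add ?IHk ?vdist_adj ?walk_adj// ltnW.
Qed.

Lemma walk_pt_lip t t' : (0 < size s)%N -> 0 <= t -> t <= t' -> t' <= (size s)%:R ->
  d (walk_pt t) (walk_pt t') <= t' - t.
Proof.
move=> s0 t0 tt' t's.
have [|i [r [si /andP[r0 r1] tE xE]]] := @walk_ptP t _ s0; first by lra.
have [|j [r' [sj /andP[r0' r1'] tE' yE]]] := @walk_ptP t' _ s0; first by lra.
have [ij|ji|ij] := ltngtP i j.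
- have ti : d (walk_pt t) (vpt (W i.+1)) <= 1 - r.
    have := gdist_edge (walk_adj si) (_ : 0 <= r <= 1) (_ : 0 <= 1 <= 1) xE.
    rewrite distrC ger0_norm ?subr_ge0//; apply; rewrite ?r0 ?ler01 ?lexx//.
    by rewrite seg1.
  have tj : d (vpt (W j)) (walk_pt t') <= r'.
    have := gdist_edge (walk_adj sj) (_ : 0 <= 0 <= 1) (_ : 0 <= r' <= 1) _ yE.
    rewrite sub0r normrN ger0_norm//; apply; rewrite ?r0' ?ler01 ?lexx//.
    by rewrite seg0.
  have ij' : d (vpt (W i.+1)) (vpt (W j)) <= (j - i.+1)%:R.
    by rewrite gdist_vpt ler_nat -{1}(subnKC ij) walk_vdist// subnKC// ltnW.
  have := gdist_tri (vpt (W i.+1)) (walk_pt t) (walk_pt t').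
  have := gdist_tri (vpt (W j)) (vpt (W i.+1)) (walk_pt t').
  by move: ij'; rewrite natrB// -natr1; lra.
- have -> : t = t' by move: ji; rewrite -(ler_nat R) -natr1; lra.
  by rewrite gdistxx subrr.
- subst j; apply: le_trans (gdist_edge (walk_adj si) _ _ xE yE) _; try lra.
  by rewrite distrC ger0_norm; lra.
Qed.

(** A walk is 1-Lipschitz, so it is a geodesic as soon as its two ends are as far apart as its
    length. *)
Lemma walk_geodesic t t' : (0 < size s)%N -> 0 <= t -> t <= t' -> t' <= (size s)%:R ->
  t' - t <= d (walk_pt t) (walk_pt t') ->
  geodesic d (walk_pt t) (walk_pt t')
    (walk_pt @` [set r | t <= r <= t']).
Proof.
move=> s0 t0 tt' t's td.
have E : d (walk_pt t) (walk_pt t') = t' - t.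
  by apply/eqP; rewrite eq_le td walk_pt_lip.
have lip r r' : t <= r -> r <= r' -> r' <= t' -> d (walk_pt r) (walk_pt r') = r' - r.
  move=> tr rr' r't'; apply/eqP; rewrite eq_le walk_pt_lip//=; try lra.
  have := gdist_tri (walk_pt r) (walk_pt t) (walk_pt t').
  have := gdist_tri (walk_pt r') (walk_pt r) (walk_pt t').
  have := @walk_pt_lip t r s0 t0 tr; have := @walk_pt_lip r' t' s0.
  lra.
exists (fun r => walk_pt (t + r)); rewrite E; split.
- by rewrite addr0.
- by rewrite addrC subrK.
- have ordered r r' : 0 <= r -> r <= r' -> r' <= t' - t ->
      d (walk_pt (t + r)) (walk_pt (t + r')) = r' - r.
    by move=> r0 rr' r't; rewrite lip ?lerD2l ?lerDl//; [ring|rewrite addrC -lerBrDr].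
  move=> r r' /andP[r0 r1] /andP[r'0 r'1]; have [rr'|/ltW rr'] := leP r r'.
    by rewrite ordered// distrC ger0_norm// subr_ge0.
  by rewrite gdistC ordered// ger0_norm// subr_ge0.
apply/seteqP; split=> _ [r /= r01 <-].
  by exists (r - t); [lra|congr walk_pt; ring].
by exists (t + r); [lra|].
Qed.

End Walks.

Section LowerBounds.
Variables (R : realType) (G : graph).
Implicit Types (u v w : G) (x y z p q : point R G) (t : R).
Local Notation vpt := (@vpt R G).
Local Notation d := (@gdist R G).

(** A route from x to z spends at least 1 - cx to reach a vertex, k.+1 between vertices and 1 - cz
    at the end. If instead it stays in one edge, the disjoint supports make x and z opposite ends of
    that edge, and k = 0. *)
Lemma gdist_lower x z k cx cz :
  (forall w w', 0 < x w -> 0 < z w' -> (k < vdist w w')%N) ->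
  (forall w, x w <= cx) -> (forall w, z w <= cz) ->
  (1 - cx) + k.+1%:R + (1 - cz) <= d x z.
Proof.
move=> kD xc zc.
have [[u [v [s [t [uv [/andP[s0 s1] /andP[t0 t1]] xs zt ->]]]]]|[w [xw ->]]] :=
    gdist_cases x z; last first.
  have [w' [zw' E]] := gdist_vertex z w; rewrite [d _ z]gdistC E.
  by have := kD _ _ xw zw'; have := xc w; have := zc w'; rewrite vdistC -(ler_nat R); lra.
have disj w : 0 < x w -> 0 < z w -> False.
  by move=> xw zw; have := kD _ _ xw zw; rewrite vdistxx.
have xu : x u = 1 - s by rewrite xs segl.
have xv : x v = s by rewrite xs segr.
have zu : z u = 1 - t by rewrite zt segl.
have zv : z v = t by rewrite zt segr.
have k1 w w' : 0 < x w -> 0 < z w' -> w = u \/ w = v -> w' = u \/ w' = v -> k = 0%N.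
  move=> xw zw' wuv w'uv; have := kD _ _ xw zw'.
  have vu : adj v u by rewrite adj_sym.
  by case: wuv w'uv => -> [->|->]; rewrite ?vdistxx//; do ?[move/vdist_adj: uv|move/vdist_adj: vu]; lia.
have [w xw] := exists_supp x; have [w' zw'] := exists_supp z.
have k0 : k = 0%N.
  by apply: (k1 w w') => //; [move: xw; rewrite xs|move: zw'; rewrite zt] => /seg_supp.
have := disj u; have := disj v; rewrite xu xv zu zv k0.
have := xc u; have := xc v; have := zc u; have := zc v; rewrite xu xv zu zv.
move=> c1 c2 c3 c4 dv du.
have [s_le0|s_gt0] := leP s 0; have [t_le0|t_gt0] := leP t 0.
- by exfalso; apply: du; lra.
- have [|t_lt1] := leP 1 t; last by exfalso; apply: du; lra.
  by rewrite distrC => *; have := ler_norm (t - s); lra.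
- have [|s_lt1] := leP 1 s; last by exfalso; apply: du; lra.
  by move=> *; have := ler_norm (s - t); lra.
- by exfalso; apply: dv; lra.
Qed.

Lemma coord_mid_le x u v w : adj u v -> coord x = seg u v (1 / 2) -> x w <= 1 / 2.
Proof.
move=> uv xE; have [xw|] := ltP 0 (x w); last by lra.
by move: (xw); rewrite xE => /seg_supp[]->; rewrite ?segl ?segr//; lra.
Qed.

End LowerBounds.

Section PentagonLowerBound.
Variables (R : realType).

Lemma gdist_mid_vertex (G : graph) (x : point R G) a b c k : adj a b ->
  coord x = seg a b (1 / 2) -> (k < vdist a c)%N -> (k < vdist b c)%N ->
  1 / 2 + k.+1%:R <= gdist x (vpt R c).
Proof.
move=> ab xE ac bc.
suff : (1 - 1 / 2) + k.+1%:R + (1 - 1) <= gdist x (vpt R c) by lra.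
apply: gdist_lower => [w w' xw /vtx_supp ->|w|w].
- by move: xw; rewrite xE => /seg_supp[]->.
- exact: coord_mid_le ab xE.
- exact: coord_le1.
Qed.

Lemma gdist_mid_mid (G : graph) (x z : point R G) a b c c' k : adj a b ->
  adj c c' -> coord x = seg a b (1 / 2) -> coord z = seg c c' (1 / 2) ->
  (k < vdist a c)%N -> (k < vdist b c)%N ->
  (k < vdist a c')%N -> (k < vdist b c')%N -> k.+2%:R <= gdist x z.
Proof.
move=> ab cc xE zE ac bc ac' bc'.
suff : (1 - 1 / 2) + k.+1%:R + (1 - 1 / 2) <= gdist x z by rewrite -[k.+2%:R]natr1; lra.
apply: gdist_lower => [w w'|w|w].
- by rewrite xE zE => /seg_supp[]-> /seg_supp[]->.
- exact: coord_mid_le ab xE.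
- exact: coord_mid_le cc zE.
Qed.

(** The start b0 may be a neighbour of m, but a route through it costs at least 1/2 more because t
    is at least 1/2. Routes through the other vertices cost at least 2. *)
Lemma gdist_walk_far (G : graph) (b0 b1 m : G) s (t : R) :
  path (@adj G) b0 (b1 :: s) -> (0 < vdist b0 m)%N ->
  all (fun w => (1 < vdist w m)%N) (b1 :: s) ->
  1 / 2 <= t <= (size (b1 :: s))%:R ->
  3 / 2 <= gdist (vpt R m) (walk_pt b0 (b1 :: s) t).
Proof.
move=> walk b0m /allP sm /andP[t2 ts].
have t0s : 0 <= t <= (size (b1 :: s))%:R by rewrite ts andbT; lra.
have [i [r [si /andP[r0 r1] tE qE]]] := walk_ptP walk t0s isT.
set q := walk_pt _ _ _ in qE *; rewrite gdistC.
have [w [qw ->]] := gdist_vertex q m.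
have [w_s|w_ns] := boolP (w \in b1 :: s).
  by have := coord_le1 q w; have := sm _ w_s; rewrite -(ler_nat R); lra.
have ws : w \in b0 :: b1 :: s by apply: walk_supp qw.
have wb0 : w = b0 by move: ws; rewrite inE (negPf w_ns) orbF => /eqP.
subst w; case: i si tE qE => [|i] si tE qE; last first.
  have nthS j : nth b0 [:: b0, b1 & s] j.+1 = nth b0 (b1 :: s) j by [].
  by move: qw w_ns; rewrite qE => /seg_supp[]->; rewrite nthS mem_nth// ltnW.
have b01 : adj b0 b1 by case/andP: walk.
have -> : q b0 = 1 - r by rewrite qE segl.
by move: b0m; rewrite -(ler_nat R); lra.
Qed.

(* The vertices of the triangle are the midpoints x of v1 v2 and y of v4 v5 and
   the point z where the two walks end; its point far from the other sides is
   v3, in the middle of [xy]. *)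
Lemma pentagon_lower (G : graph) (v1 v2 v3 v4 v5 : G) s2 s3 (e2 e3 : R) :
  path (@adj G) v1 [:: v2; v3; v4; v5] ->
  path (@adj G) v2 (v1 :: s2) -> path (@adj G) v4 (v5 :: s3) ->
  all (fun w => (1 < vdist w v3)%N) (v1 :: s2) ->
  all (fun w => (1 < vdist w v3)%N) (v5 :: s3) ->
  (1 < vdist v1 v4)%N -> (1 < vdist v1 v5)%N ->
  (1 < vdist v2 v4)%N -> (1 < vdist v2 v5)%N ->
  1 / 2 <= e2 <= (size (v1 :: s2))%:R -> 1 / 2 <= e3 <= (size (v5 :: s3))%:R ->
  walk_pt v2 (v1 :: s2) e2 = walk_pt v4 (v5 :: s3) e3 ->
  (forall x, coord x = seg v2 v1 (1 / 2) ->
     e2 - 1 / 2 <= gdist x (walk_pt v2 (v1 :: s2) e2)) ->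
  (forall y, coord y = seg v4 v5 (1 / 2) ->
     e3 - 1 / 2 <= gdist y (walk_pt v4 (v5 :: s3) e3)) ->
  ((3 / 2 : R)%:E <= hyp_const R G)%E.
Proof.
move=> W1 W2 W3 far2 far3 v14 v15 v24 v25 /andP[e2l e2r] /andP[e3l e3r] zE xz yz.
have xE := walk_pt_mid R W1 (isT : (0 < 4)%N).
have yE := walk_pt_mid R W1 (isT : (3 < 4)%N).
have pE : walk_pt v1 [:: v2; v3; v4; v5] 2%:R = vpt R v3 by apply: walk_pt_nat W1 _ _ _.
have xE2 := walk_pt_mid R W2 (isT : (0 < size (v1 :: s2))%N).
have yE3 := walk_pt_mid R W3 (isT : (0 < size (v5 :: s3))%N).
rewrite -[0%:R]/(0 : R) !add0r /= in xE xE2 yE yE3.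
have half : 1 - 1 / 2 = 1 / 2 :> R by lra.
have [v12 v45] : adj v1 v2 /\ adj v4 v5 by move: W1 => /= /and5P[-> _ _ ->].
have v23 : adj v2 v3 /\ adj v3 v4 by move: W1 => /= /and5P[_ -> -> _].
have xx : walk_pt v1 [:: v2; v3; v4; v5] (1 / 2) = walk_pt v2 (v1 :: s2) (1 / 2) :> point R G.
  by apply: point_eq; rewrite xE xE2 segC half.
have yy : walk_pt v1 [:: v2; v3; v4; v5] (3%:R + 1 / 2) =
    walk_pt v4 (v5 :: s3) (1 / 2) :> point R G.
  by apply: point_eq; rewrite yE yE3.
have sA := @walk_geodesic R G _ _ W1 (1 / 2) (3%:R + 1 / 2) isT.
have sB := @walk_geodesic R G _ _ W3 (1 / 2) e3 isT.
have sC := @walk_geodesic R G _ _ W2 (1 / 2) e2 isT.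
rewrite xx yy in sA; rewrite -zE in sB.
have half0 : 0 <= 1 / 2 :> R by lra.
apply: (delta_space_ge (@gdist_ge0 R G) (sA half0 _ _ _) (sB half0 e3l e3r _)
    (geodesicC (@gdistC R G) (sC half0 e2l e2r _)) (_ : _ (vpt R v3))).
- lra.
- by rewrite /=; lra.
- rewrite -xx -yy; apply: le_trans (gdist_mid_mid v12 v45 xE yE v14 v24 v15 v25).
  lra.
- by rewrite zE; apply: yz.
- exact: xz.
- by exists 2%:R => //=; lra.
move=> q [] [t /= /andP[t0 t1] <-].
  apply: gdist_walk_far W3 _ far3 _; last by rewrite t0 (le_trans t1).
  by rewrite vdist_gt0// eq_sym adj_neq//; case: v23.
apply: gdist_walk_far W2 _ far2 _; last by rewrite t0 (le_trans t1).
by rewrite vdist_gt0// adj_neq//; case: v23.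
Qed.

Lemma bigon_lower (G1 G2 : graph) (a b c e : G1) (y1 y2 : G2) :
  path (@adj G1) a [:: b; c; e] -> (2 < vdist a e)%N -> y1 != y2 ->
  ((3 / 2 : R)%:E <= hyp_const R (lex_product G1 G2))%E.
Proof.
move=> /= /and4P[ab bc ce _] ae y12; set H := lex_product G1 G2.
pose W := @walk_pt R H.
have WA : path (@adj H) (a, y1) [:: (b, y1); (c, y1); (e, y1)].
  by rewrite /= /lex_adj /= ab bc ce.
have WB : path (@adj H) (e, y1) [:: (c, y2); (b, y2); (a, y1)].
  by rewrite /= /lex_adj /= [adj e c]adj_sym [adj c b]adj_sym [adj b a]adj_sym ab bc ce.
have A0 := @walk_pt_nat R H _ _ WA 0%N isT isT.
have A3 := @walk_pt_nat R H _ _ WA 3%N isT isT.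
have B0 := @walk_pt_nat R H _ _ WB 0%N isT isT.
have B3 := @walk_pt_nat R H _ _ WB 3%N isT isT.
have sA := @walk_geodesic R H _ _ WA 0%:R 3%:R isT.
have sB := @walk_geodesic R H _ _ WB 0%:R 3%:R isT.
rewrite {}A0 {}A3 in sA; rewrite {}B0 {}B3 in sB.
have pE := walk_pt_mid R WA (isT : (1 < 3)%N).
have bcH : adj ((b, y1) : H) (c, y1) by apply: adj_fst.
have D3 : 3%:R <= gdist (vpt R ((a, y1) : H)) (vpt R ((e, y1) : H)).
  by rewrite gdist_vpt ler_nat (leq_trans ae)//; apply: (@vdist_fst _ _ (a, y1) (e, y1)).
have {}sA := sA (ler0n _ _) (ler0n _ _) (lexx _) _.
have {}sB := sB (ler0n _ _) (ler0n _ _) (lexx _) _.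
rewrite subr0 /= in sA sB; rewrite [gdist _ _]gdistC in sB.
have pA : [set W (a, y1) [:: (b, y1); (c, y1); (e, y1)] r | r in
    [set r : R | 0%:R <= r <= 3%:R]] (W (a, y1) [:: (b, y1); (c, y1); (e, y1)] (1%:R + 1 / 2)).
  by exists (1%:R + 1 / 2) => //=; lra.
apply: (delta_space_ge (@gdist_ge0 R H) (sA D3) (sB D3)
    (geodesic_refl (@gdistxx R H) _) pA).
move=> q qBC.
have supp w : 0 < q w -> w \in ([:: (e, y1); (c, y2); (b, y2); (a, y1)] : seq H).
  case: qBC => [[t /= t03 <-]|-> /vtx_supp ->]; last by rewrite !inE eqxx ?orbT.
  by apply: walk_supp.
(* The midpoint contributes 1/2 and disjointness of the supports contributes 1; nothing is claimed
   about the position of q on the second side. The third side is reduced to a point. *)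
suff : (1 - 1 / 2) + 1%:R + (1 - 1) <= gdist (W (a, y1) [:: (b, y1); (c, y1); (e, y1)] (1%:R + 1 / 2)) q by lra.
have be : b != e.
  apply: contraTneq ae => be; rewrite -be -leqNgt.
  by rewrite (leq_trans (vdist_adj ab)).
have ba : b != a by rewrite eq_sym adj_neq.
have ca : c != a.
  apply: contraTneq ae => ca; rewrite -ca -leqNgt.
  by rewrite (leq_trans (vdist_adj ce)).
apply: gdist_lower => [w w' xw /supp|w|w].
- move=> qw'; apply: vdist_gt0; apply: contraTneq qw' => <-.
  move: xw; rewrite pE => /seg_supp[]-> /=; rewrite !inE !xpair_eqE (negPf y12).
    by rewrite (negPf be) (negPf ba) !andbF.
  by rewrite (negPf (adj_neq ce)) (negPf ca) !andbF.
- exact: coord_mid_le bcH pE.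
- exact: coord_le1.
Qed.

End PentagonLowerBound.

Section Pentagons.
Variables (R : realType) (G : graph) (v1 v2 v3 v4 v5 : G) (s2 s3 : seq G).
Hypotheses (W1 : path (@adj G) v1 [:: v2; v3; v4; v5])
  (v14 : (1 < vdist v1 v4)%N) (v15 : (1 < vdist v1 v5)%N)
  (v24 : (1 < vdist v2 v4)%N) (v25 : (1 < vdist v2 v5)%N).

Let v12 : adj v2 v1.
Proof. by case/andP: W1; rewrite adj_sym. Qed.

Let v45 : adj v4 v5.
Proof. by case/and5P: W1. Qed.

(** Here z is the vertex c, closing a cycle with [6 + size s2 + size s3] vertices. In the companion
    [pentagon_edge], z is the middle of an edge and there is one more vertex. *)
Lemma pentagon_vertex c :
  path (@adj G) v2 (v1 :: rcons s2 c) -> path (@adj G) v4 (v5 :: rcons s3 c) ->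
  all (fun w => (1 < vdist w v3)%N) (v1 :: rcons s2 c) ->
  all (fun w => (1 < vdist w v3)%N) (v5 :: rcons s3 c) ->
  (size s2 < vdist v2 c)%N -> (size s2 < vdist v1 c)%N ->
  (size s3 < vdist v4 c)%N -> (size s3 < vdist v5 c)%N ->
  ((3 / 2 : R)%:E <= hyp_const R G)%E.
Proof.
move=> W2 W3 far2 far3 d2 d1 d4 d5.
have zE v w s : path (@adj G) v (w :: rcons s c) ->
    walk_pt v (w :: rcons s c) (size s).+2%:R = vpt R c.
  move=> W; rewrite (walk_pt_nat R W) /= ?size_rcons//.
  by rewrite nth_rcons ltnn eqxx.
have pos k : 1 / 2 <= k.+2%:R :> R.
  by have := ler0n R k; rewrite -[k.+2%:R]natr1 -[k.+1%:R]natr1; lra.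
apply: (pentagon_lower (e2 := (size s2).+2%:R) (e3 := (size s3).+2%:R) W1 W2 W3) => //.
- by rewrite pos /= size_rcons lexx.
- by rewrite pos /= size_rcons lexx.
- by rewrite !zE.
- by move=> x xE; rewrite zE//; have := gdist_mid_vertex v12 xE d2 d1; rewrite -[(size _).+2%:R]natr1; lra.
- by move=> x xE; rewrite zE//; have := gdist_mid_vertex v45 xE d4 d5; rewrite -[(size _).+2%:R]natr1; lra.
Qed.

Lemma pentagon_edge c c' :
  path (@adj G) v2 (v1 :: rcons (rcons s2 c) c') ->
  path (@adj G) v4 (v5 :: rcons (rcons s3 c') c) ->
  all (fun w => (1 < vdist w v3)%N) (v1 :: rcons (rcons s2 c) c') ->
  all (fun w => (1 < vdist w v3)%N) (v5 :: rcons (rcons s3 c') c) ->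
  (size s2 < vdist v2 c)%N -> (size s2 < vdist v1 c)%N ->
  (size s2 < vdist v2 c')%N -> (size s2 < vdist v1 c')%N ->
  (size s3 < vdist v4 c)%N -> (size s3 < vdist v5 c)%N ->
  (size s3 < vdist v4 c')%N -> (size s3 < vdist v5 c')%N ->
  ((3 / 2 : R)%:E <= hyp_const R G)%E.
Proof.
move=> W2 W3 far2 far3 d2 d1 d2' d1' d4 d5 d4' d5'.
have zE v w s a b : path (@adj G) v (w :: rcons (rcons s a) b) ->
    coord (walk_pt v (w :: rcons (rcons s a) b) ((size s).+2%:R + 1 / 2)) =
    seg a b (1 / 2) :> (G -> R).
  move=> W; rewrite (walk_pt_mid R W) /= ?size_rcons// nth_rcons size_rcons ltnSn.
  by rewrite nth_rcons ltnn eqxx nth_rcons size_rcons ltnn eqxx.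
have pos k : 1 / 2 <= k.+2%:R + 1 / 2 :> R.
  by have := ler0n R k; rewrite -[k.+2%:R]natr1 -[k.+1%:R]natr1; lra.
have le3 k : k.+2%:R + 1 / 2 <= k.+3%:R :> R by rewrite -[k.+3%:R]natr1; lra.
have cc : adj c c'.
  by move: W2; rewrite -cat1s -!cats1 !cat_path /= !last_cat /= => /and4P[_ _ + _]; case: (s2).
apply: (pentagon_lower (e2 := (size s2).+2%:R + 1 / 2)
  (e3 := (size s3).+2%:R + 1 / 2) W1 W2 W3) => //.
- by rewrite pos /= !size_rcons le3.
- by rewrite pos /= !size_rcons le3.
- by apply: point_eq; rewrite !zE// segC; congr seg; lra.
- by move=> x xE; have := gdist_mid_mid v12 cc xE (zE _ _ _ _ _ W2) d2 d1 d2' d1'; lra.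
- move=> x xE; have c'c : adj c' c by rewrite adj_sym.
  by have := gdist_mid_mid v45 c'c xE (zE _ _ _ _ _ W3) d4' d5' d4 d5; lra.
Qed.

End Pentagons.

(* As in [cycle_edges], labels run from 1 to n. *)
Definition labelled_adj n (chords : seq (nat * nat)) (i j : nat) : bool :=
  let E := cycle_edges n ++ chords in ((i, j) \in E) || ((j, i) \in E).

Definition labelled_far n (chords : seq (nat * nat)) (i j : nat) : bool :=
  [&& i \in iota 1 n, j \in iota 1 n, i != j & ~~ labelled_adj n chords i j].

(** The point z is a vertex for the 6-cycle and the first kind of 8-cycle, and the middle of an edge
    in the other three families. A chord such as v2 v6 in the 6-cycle is harmless: when z directly
    follows v1, it only has to differ from v2. *)
Lemma family_lower (R : realType) (G : graph) n allowed (V : nat -> G) :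
  (n, allowed) \in chord_families ->
  (forall i j, labelled_adj n [::] i j -> adj (V i) (V j)) ->
  (forall i j, labelled_far n allowed i j -> (1 < vdist (V i) (V j))%N) ->
  (forall i j, [&& i \in iota 1 n, j \in iota 1 n & i != j] ->
     (0 < vdist (V i) (V j))%N) ->
  ((3 / 2 : R)%:E <= hyp_const R G)%E.
Proof.
rewrite !inE => /orP[|/orP[|/orP[|/orP[]]]] /eqP[-> ->] Vadj Vfar Vneq.
- by apply: (@pentagon_vertex R G (V 1) (V 2) (V 3) (V 4) (V 5) [::] [::] _ _ _ _ _ (V 6));
    rewrite /= ?Vadj ?Vfar ?Vneq.
- by apply: (@pentagon_edge R G (V 1) (V 2) (V 3) (V 4) (V 5) [::] [::] _ _ _ _ _ (V 7) (V 6));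
    rewrite /= ?Vadj ?Vfar ?Vneq.
- by apply: (@pentagon_vertex R G (V 1) (V 2) (V 3) (V 4) (V 5) [:: V 8] [:: V 6] _ _ _ _ _ (V 7));
    rewrite /= ?Vadj ?Vfar ?Vneq.
- by apply: (@pentagon_edge R G (V 1) (V 2) (V 3) (V 4) (V 5) [:: V 8] [::] _ _ _ _ _ (V 7) (V 6));
    rewrite /= ?Vadj ?Vfar ?Vneq.
- by apply: (@pentagon_edge R G (V 1) (V 2) (V 3) (V 4) (V 5) [:: V 9] [:: V 6] _ _ _ _ _ (V 8) (V 7));
    rewrite /= ?Vadj ?Vfar ?Vneq.
Qed.

(** The cycle is placed in one fibre. Other fibres may create shortcuts, but none shorter than 2,
    and [family_lower] asks for no distance above 2. *)
Lemma family_hyp_lower (R : realType) (G1 G2 : graph) : family_F G2 ->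
  ((3 / 2 : R)%:E <= hyp_const R (lex_product G1 G2))%E.
Proof.
move=> [n [allowed [chords [nF chF [f finj fadj]]]]].
have [u] := graph_inhabited G1.
case: n f finj fadj nF => [|m] f finj fadj nF; first by rewrite !inE in nF.
pose V k : lex_product G1 G2 := (u, f (inord k.-1)).
have inordE k : k \in iota 1 m.+1 -> nat_of_ord (inord k.-1 : 'I_m.+1) = k.-1.
  by rewrite mem_iota => km; rewrite inordK//; lia.
have VE i j : i \in iota 1 m.+1 -> j \in iota 1 m.+1 ->
    adj (V i) (V j) = labelled_adj m.+1 chords i j.
  move=> im jm; rewrite adj_lexE /= adj_irr eqxx /= fadj /cycle_with_chords.
  rewrite !inordE//; rewrite !mem_iota in im jm.
  by rewrite !prednK//; lia.
have Vneq i j : [&& i \in iota 1 m.+1, j \in iota 1 m.+1 & i != j] -> V i != V j.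
  move=> /and3P[im jm ij]; rewrite /V xpair_eqE eqxx /= (inj_eq finj).
  rewrite -val_eqE /= !inordE//; apply: contraNneq ij.
  by move: im jm; rewrite !mem_iota; lia.
have range i j : labelled_adj m.+1 [::] i j -> i \in iota 1 m.+1 /\ j \in iota 1 m.+1.
  rewrite /labelled_adj cats0 /cycle_edges !mem_rcons !inE !mem_iota.
  have mapP' a b : (a, b) \in [seq (k, k.+1) | k <- iota 1 m.+1.-1] ->
      [/\ (0 < a)%N, (a < m.+1)%N & b = a.+1].
    by move=> /mapP[k]; rewrite mem_iota => km [-> ->]; split=> //; lia.
  by case/orP=> /orP[/eqP[-> ->]|/mapP'[? ? ->]]; lia.
apply: (family_lower R (V := V) nF) => i j.
- move=> ij; have [im jm] := range i j ij; rewrite VE//.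
  move: ij; rewrite /labelled_adj cats0 => /orP[]ij; apply/orP; [left|right];
  by rewrite mem_cat ij.
- move=> /and4P[im jm ij nadj]; apply: vdist_gt1; first by rewrite Vneq// im jm.
  rewrite VE//; apply: contra nadj; rewrite /labelled_adj !mem_cat.
  by case/orP=> /orP[->|/chF ->]; rewrite ?orbT.
- by move=> /Vneq/vdist_gt0.
Qed.

(** * Triangles that are not 5/4-thin *)

Section SideWalks.
Variables (R : realType) (G : graph).
Implicit Types (u v w a b : G) (x y z p q : point R G) (s t r : R).
Local Notation vpt := (@vpt R G).
Local Notation d := (@gdist R G).

Lemma gdist_vpt_eq0 q u : d (vpt u) q <= 0 -> q = vpt u.
Proof.
rewrite gdistC; have [w [qw ->]] := gdist_vertex q u => h.
have q1 := coord_le1 q w; have D := ler0n R (vdist w u).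
have /vdist0 <- : vdist w u = 0%N by apply/eqP; rewrite -(pnatr_eq0 R); lra.
by apply: coord1; lra.
Qed.

Lemma gdist_vpt_eq1 q u : d (vpt u) q = 1 -> exists2 w, q = vpt w & adj u w.
Proof.
rewrite gdistC; have [w [qw ->]] := gdist_vertex q u => h.
have q1 := coord_le1 q w; case D: (vdist w u) h => [|[|n]] h; first by lra.
  by exists w; [apply: coord1; lra|rewrite adj_sym vdist1].
by have := ler0n R n; move: h; rewrite -[n.+2%:R]natr1 -[n.+1%:R]natr1; lra.
Qed.

Lemma gdist_vpt_lt1 q u : d (vpt u) q < 1 -> 0 < q u /\ d (vpt u) q = 1 - q u.
Proof.
rewrite gdistC; have [w [qw ->]] := gdist_vertex q u => h.
have q1 := coord_le1 q w; case D: (vdist w u) h => [|n] h.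
  by rewrite -(vdist0 D) addr0.
by have := ler0n R n; move: h; rewrite -natr1; lra.
Qed.

Lemma gdist_from_edge x a b s q : adj a b -> 0 < s < 1 -> coord x = seg a b s ->
  [\/ exists r, [/\ 0 <= r <= 1, coord q = seg a b r & d x q = `|s - r|],
    d x q = s + d (vpt a) q | d x q = 1 - s + d (vpt b) q].
Proof.
move=> ab s01 xE; have [[u [v [r [r' [uv [r01 r01'] xr qr dE]]]]]|[w [xw wE]]] :=
    gdist_cases x q.
  constructor 1; have E : seg a b s = seg u v r by rewrite -xE.
  have [[-> [-> <-]]|[-> [-> rE]]] := seg_inj ab uv s01 E; first by exists r'.
  exists (1 - r'); rewrite -?segC dE rE; split=> //; first by lra.
  by rewrite -normrN; congr (`|_|); ring.
have xa : x a = 1 - s by rewrite xE segl.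
have xb : x b = s by rewrite xE segr.
move: (xw); rewrite xE => /seg_supp[]wab; subst w; [constructor 2|constructor 3].
  by rewrite wE xa; lra.
by rewrite wE xb.
Qed.

Section Geodesic.
Variables (g : R -> point R G) (l : R).
Hypothesis gd : forall s t, 0 <= s <= l -> 0 <= t <= l -> d (g s) (g t) = `|s - t|.
Variables (a b : G) (s : R).
Hypotheses (ab : adj a b) (s0 : 0 < s) (s1 : s <= 1 / 2)
  (g0 : coord (g 0) = seg a b s) (ga : forall t, 0 <= t <= l -> g t <> vpt a).

(** A distance from x realized through a does not say which way the geodesic went. The position at
    time s decides: being at distance s from x and different from a, it must be the point 2s of the
    edge, and from there a route through a is too long. *)
Lemma geodesic_initial t : 0 <= t -> t <= l -> t <= 1 - s ->
  exists2 r, 0 < r <= 1 & coord (g t) = seg a b r.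
Proof.
move: (s0) (s1) => s_gt0 s_le t0 tl ts.
have in_edge t' r : 0 <= t' <= l -> 0 <= r <= 1 -> coord (g t') = seg a b r ->
    exists2 r, 0 < r <= 1 & coord (g t') = seg a b r.
  move=> t'l /andP[]; rewrite le_eqVlt => /predU1P[<-|r0] r1 gE; last first.
    by exists r; rewrite ?r0.
  by case: (ga t'l); apply: point_eq; rewrite gE seg0.
have at_end t' : d (vpt b) (g t') <= 0 -> exists2 r, 0 < r <= 1 & coord (g t') = seg a b r.
  by move=> /gdist_vpt_eq0 ->; exists 1; rewrite ?ltr01 ?lexx// seg1.
have dg t' : 0 <= t' -> t' <= l -> d (g 0) (g t') = t'.
  by move=> t'0 t'l; rewrite gd ?sub0r ?normrN ?ger0_norm//; lra.
have s01 : 0 < s < 1 by lra.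
have dgt := dg t t0 tl.
have [[r [r01 gE _]]|gE|gE] := gdist_from_edge (g t) ab s01 g0.
- by apply: in_edge gE => //; rewrite t0.
- have st : s <= t by have := gdist_ge0 (vpt a) (g t); lra.
  have sl : 0 <= s <= l by lra.
  have dgs : d (g 0) (g s) = s by apply: dg; lra.
  have gs2 : coord (g s) = seg a b (2 * s).
    have [[r [r01 gsE rE]]|gsE|gsE] := gdist_from_edge (g s) ab s01 g0.
    - have [r' /andP[r'0 r'1] gsE'] := in_edge _ _ sl r01 gsE.
      have rr : r = r' by rewrite -(segr r ab) -gsE gsE' segr.
      by rewrite gsE; congr seg; move: rE; rewrite dgs rr; case: ger0P; lra.
    - case: (ga sl); apply: gdist_vpt_eq0; lra.
    - have b0 := gdist_ge0 (vpt b) (g s).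
      rewrite (@gdist_vpt_eq0 (g s) b); last lra.
      by rewrite (_ : 2 * s = 1) ?seg1//; lra.
  have [s2|s2] := ltP (2 * s) 1; last first.
    have ts' : t = s by lra.
    by exists (2 * s); rewrite ?ts'//; lra.
  have dst : d (g s) (g t) = t - s by rewrite gd ?t0// distrC ger0_norm//; lra.
  have s201 : 0 < 2 * s < 1 by lra.
  have [[r [r01 gtE _]]|gtE|gtE] := gdist_from_edge (g t) ab s201 gs2.
  + by apply: in_edge gtE => //; rewrite t0.
  + by exfalso; lra.
  + by apply: at_end; lra.
- by apply: at_end; lra.
Qed.

Lemma geodesic_initial_end : 1 - s <= l -> g (1 - s) = vpt b.
Proof.
move: (s0) (s1) => s_gt0 s_le.
move=> sl; have [|r /andP[r0 r1] gE] := geodesic_initial _ sl (lexx _); first by lra.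
have s01 : 0 <= s <= 1 by lra.
have r01 : 0 <= r <= 1 by lra.
have dl : d (g 0) (g (1 - s)) = 1 - s.
  by rewrite gd ?sub0r ?normrN ?ger0_norm//; lra.
have := gdist_edge ab s01 r01 g0 gE; rewrite dl => h.
suff rE : r = 1 by apply: point_eq; rewrite gE rE seg1.
by move: h; case: ger0P; lra.
Qed.

End Geodesic.

(** The number n only bounds the remaining length, for the induction. The list ws collects the
    vertices met at times t + 1, t + 2, and so on; the last vertex met is less than 1 away from the
    end of the geodesic. *)
Lemma geodesic_walk_from (g : R -> point R G) (l : R) n : 0 <= l ->
  (forall s t, 0 <= s <= l -> 0 <= t <= l -> d (g s) (g t) = `|s - t|) ->
  forall t w, 0 <= t <= l -> g t = vpt w -> l - t < n.+1%:R ->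
  exists ws, [/\ path (@adj G) w ws,
    forall v, v \in ws -> exists2 r, 0 <= r <= l & g r = vpt v,
    0 < g l (last w ws) & l - t = (size ws)%:R + (1 - g l (last w ws))].
Proof.
move=> l0 gd; elim: n => [|n IHn] t w /andP[t0 tl] gtw ltn.
  have dl : d (vpt w) (g l) = l - t.
    by rewrite -gtw gd ?t0 ?l0 ?lexx// distrC ger0_norm ?subr_ge0.
  have [|gw dE] := @gdist_vpt_lt1 (g l) w; first by rewrite dl.
  by exists [::]; split=> //=; rewrite -dl dE add0r.
have [lt1|lt1] := ltP (l - t) 1.
  have dl : d (vpt w) (g l) = l - t.
    by rewrite -gtw gd ?t0 ?l0 ?lexx// distrC ger0_norm ?subr_ge0.
  have [|gw dE] := @gdist_vpt_lt1 (g l) w; first by rewrite dl.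
  by exists [::]; split=> //=; rewrite -dl dE add0r.
have t1l : 0 <= t + 1 <= l by lra.
have [w' gw' ww'] : exists2 w', g (t + 1) = vpt w' & adj w w'.
  apply: gdist_vpt_eq1; rewrite -gtw gd ?t0//.
  by rewrite opprD addNKr normrN1.
have [|ws [w'ws gws gl lE]] := IHn _ _ t1l gw'.
  by move: ltn; rewrite -[n.+2%:R]natr1; lra.
exists (w' :: ws); rewrite /= ww'; split=> //.
  by move=> v; rewrite inE => /predU1P[->|/gws//]; exists (t + 1).
by rewrite -natr1; lra.
Qed.

(** A side that avoids a leaves x through b, and ws lists the vertices visited after b; being
    geodesic, it has at most two of them in diameter 2. If the side stops before b, then ws is empty
    and z lies on ab, so the length formula is restricted to nonempty ws. *)
Lemma side_walk x z A a b s : (forall u v, (vdist u v <= 2)%N) ->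
  geodesic d x z A -> adj a b -> 0 < s -> s <= 1 / 2 -> coord x = seg a b s ->
  ~ A (vpt a) ->
  exists ws, [/\ path (@adj G) b ws, (size ws <= 2)%N,
    forall v, v \in ws -> A (vpt v), 0 < z (last b ws) &
    ws <> [::] -> d x z = 1 - s + (size ws)%:R + (1 - z (last b ws))].
Proof.
move=> D2 [g [g0 g1 gd ->]] ab s0 s1 xE Aa.
have l0 := gdist_ge0 x z; set l := d x z in g1 gd l0 Aa *.
have ga t : 0 <= t <= l -> g t <> vpt a by move=> tl gta; apply: Aa; exists t.
rewrite -g0 in xE; have [ls|ls] := ltP l (1 - s).
  exists [::]; split=> //=.
  have [//||r /andP[r0 r1] zE] := geodesic_initial gd ab s0 s1 xE ga l0; try lra.
  by rewrite -g1 zE segr.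
have gb := geodesic_initial_end gd ab s0 s1 xE ga ls.
have sl : 0 <= 1 - s <= l by lra.
have [|ws [bws gws gl lE]] := @geodesic_walk_from g l (Num.bound l) l0 gd _ _ sl gb.
  apply: lt_trans (_ : (Num.bound l)%:R < _); last by rewrite ltr_nat.
  by apply: le_lt_trans (archi_boundP l0); lra.
rewrite g1 in gl lE; exists ws; split=> //; last by move=> _; rewrite -addrA -lE; lra.
have : (size ws <= vdist b (last b ws))%N; last by move/leq_trans; apply.
rewrite -(ler_nat R); have := gdist_vertex_le b gl.
have -> : d z (vpt b) = l - (1 - s).
  by rewrite -g1 -gb gd ?l0 ?lexx// ger0_norm ?subr_ge0.
by rewrite lE vdistC; lra.
Qed.


(** One step from u towards x and one from v towards y end at vertices within 2 of each other, so
    d(x,y) is at most |d(x,u) - 1| + 2 + |d(v,y) - 1|. Compared with d(x,u) + 1 + d(v,y) and the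
    bounds 5/4, this leaves only d(x,u) >= 1 and d(v,y) <= 1/2, whence t < 1/4. *)
Lemma far_center x y p u v t : (forall u v, (vdist u v <= 2)%N) ->
  adj u v -> 0 <= t -> t <= 1 / 2 -> d p (vpt u) <= t ->
  5 / 4 < d x (vpt u) + t -> 5 / 4 < 1 - t + d (vpt v) y ->
  d x y = d x (vpt u) + 1 + d (vpt v) y ->
  exists a, [/\ adj a u, d p (vpt u) < 1 / 4 &
    d x y = d x (vpt a) + 2 + d (vpt v) y].
Proof.
move=> D2 uv t0 t2 pu xu vy E.
have ntG : ~ trivial_graph G.
  by case=> w wE; move: uv; rewrite (wE u) (wE v) adj_irr.
have [a [ua xa]] := neighbor_toward x u ntG.
have [b [vb yb]] := neighbor_toward y v ntG.
have dle w w' : d (vpt w) (vpt w') <= 2 by rewrite gdist_vpt (ler_nat _ _ 2).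
have xub := gdist_tri (vpt a) x (vpt b); have xvb := gdist_tri (vpt a) x (vpt v).
have xyb := gdist_tri (vpt b) x y; have ab := dle a b; have av := dle a v.
rewrite [d (vpt b) y]gdistC in xyb; rewrite [d (vpt v) y]gdistC in vy E *.
have [xu1 t4] : 1 <= d x (vpt u) /\ t < 1 / 4.
  by move: xa yb; case: ger0P => ?; case: ger0P => *; split; lra.
have [a' [ua' xa']] := step_toward xu1.
by exists a'; split; [rewrite adj_sym|lra|lra].
Qed.

Lemma edge_of_near_vertex x a s : 0 < s -> s < 1 -> d x (vpt a) = s ->
  exists2 b, adj a b & coord x = seg a b s.
Proof.
move=> s0 s1 xa; have [|xa0 xaE] := @gdist_vpt_lt1 x a; first by rewrite gdistC xa.
rewrite gdistC xa in xaE; have [xv|[b [r [ab _ xE]]]] := supp_rep xa0.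
  by move: xa; rewrite xv gdistxx => s00; rewrite s00 ltxx in s0.
by exists b => //; move: xaE; rewrite xE segl// subKr => ->.
Qed.

Lemma edge_end x a b s : adj a b -> 0 <= s <= 1 -> coord x = seg a b s ->
  d x (vpt b) <= 1 - s.
Proof.
move=> ab s01 xE; have := gdist_edge ab s01 (_ : 0 <= 1 <= 1) xE.
rewrite distrC ger0_norm ?subr_ge0; last by case/andP: s01.
by apply; rewrite ?ler01 ?lexx// seg1.
Qed.

Lemma supp_sum x w w' : 0 < x w -> 0 < x w' -> w != w' -> x w + x w' = 1.
Proof.
move=> /supp_rep[->/= /vtx_supp ->|[v [t [wv _ xE]]]]; first by rewrite eqxx.
rewrite xE => /seg_supp[]->; first by rewrite eqxx.
by rewrite segl// segr// subrK.
Qed.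

(* A side which needs two further vertices is too long for its end to be
   reached through a. *)
Lemma side_far x z s a c c' k : (0 < s)%R -> s <= 1 / 2 -> d x (vpt a) = s ->
  d x z = 1 - s + 2 + (1 - z c) -> 0 < z c -> 0 < z c' ->
  k = c \/ k = c' -> (1 < vdist a k)%N.
Proof.
move=> s0 s1 xa xz zc zc' kE; rewrite ltnNge -(ler_nat R); apply/negP => ak.
have zk : 0 < z k by case: kE => ->.
have := gdist_tri (vpt a) x z; have := gdist_vertex_le a zk.
rewrite vdistC [d (vpt a) z]gdistC => h1 h2.
have c1 := coord_le1 z c.
have [kc|kc] := eqVneq k c; first by subst k; lra.
case: kE kc => [->|kE]; first by rewrite eqxx.
by subst k; move=> /(supp_sum zc' zc); lra.
Qed.

End SideWalks.

Section FarConfiguration.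
Variables (R : realType) (G : graph).
Local Notation vpt := (@vpt R G).
Local Notation d := (@gdist R G).

(* When all vertices are within distance 2, the far point p can only be near the
   middle vertex v3 of an induced path v1 v2 v3 v4 v5, with x on v1 v2 and y on
   v4 v5, at distance at most 1/2 from v2 and v4.  Starting from x and y, the
   other sides must leave towards v1 and v5, and they avoid the neighbours of v3.
   Asking for a distance greater than 5/4 only, rather than 3/2, spares us from
   showing that the supremum defining the hyperbolicity constant is attained. *)
Lemma far_configuration (x y z p : point R G) A B C e :
  (forall u v : G, (vdist u v <= 2)%N) -> 5 / 4 < e ->
  geodesic d x y A -> geodesic d y z B -> geodesic d z x C -> A p ->
  (forall q, (B `|` C) q -> e <= d p q) ->
  exists v1 v2 v3 v4 v5 s1 s5,
    [/\ path (@adj G) v1 [:: v2; v3; v4; v5],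
        [/\ 1 < vdist v1 v4, 1 < vdist v1 v5, 1 < vdist v2 v4 & 1 < vdist v2 v5]%N,
        path (@adj G) v1 s1 /\ path (@adj G) v5 s5,
        forall w, w \in (v1 :: s1) ++ (v5 :: s5) -> (1 < vdist w v3)%N
      & [/\ (size s1 <= 2)%N, (size s5 <= 2)%N,
          last v1 s1 = last v5 s5 \/ adj (last v1 s1) (last v5 s5),
          size s1 = 2 -> forall w, w = last v1 s1 \/ w = last v5 s5 -> (1 < vdist v2 w)%N
        & size s5 = 2 -> forall w, w = last v1 s1 \/ w = last v5 s5 -> (1 < vdist v4 w)%N]].
Proof.
move=> D2 e54 xy yz zx Ap far.
have d0 := @gdist_ge0 R G; have dC := @gdistC R G.
have xz := geodesicC dC zx; have zy := geodesicC dC yz.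
have px : e <= d p x by apply: far; right; apply: geodesic_start xz.
have py : e <= d p y by apply: far; left; apply: geodesic_start yz.
have E := geodesic_between xy Ap.
have [a [m [b [am mb pm dE]]]] : exists a m b, [/\ adj a m, adj m b,
    d p (vpt m) < 1 / 4 & d x y = d x (vpt a) + 2 + d (vpt b) y].
  have xp : d x p = d p x by rewrite dC.
  have [||u [v [t [uv /andP[t0 t1] [pu pv] Eu Ev]]]] := geodesic_edge E; try lra.
  have [t2|t2] := leP t (1 / 2).
    have [|||a [au pu4 aE]] := far_center D2 uv t0 t2 pu (y := y) (x := x); try lra.
    by exists a, u, v.
  have vu : adj v u by rewrite adj_sym.
  have yx : d y x = d y (vpt v) + 1 + d (vpt u) x.
    by rewrite dC -E Eu Ev [d y _]dC [d _ x]dC; lra.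
  have h1 : 5 / 4 < d y (vpt v) + (1 - t) by rewrite [d y _]dC; lra.
  have h2 : 5 / 4 < 1 - (1 - t) + d (vpt u) x by rewrite [d _ x]dC; lra.
  have [||a [av pv4 aE]] := far_center D2 vu _ _ pv h1 h2 yx; try lra.
  exists u, v, a; split=> //; first by rewrite adj_sym.
  by rewrite dC aE [d (vpt u) x]dC [d y _]dC; lra.
set s := d x (vpt a) in dE; set t := d (vpt b) y in dE.
have ntG : ~ trivial_graph G.
  by case=> w wE; move: am; rewrite (wE a) (wE m) adj_irr.
have dle w w' : d (vpt w) (vpt w') <= 2 by rewrite gdist_vpt (ler_nat _ _ 2).
(* A neighbour of a at distance at most |s - 1| from x is within 2 of b, so s + 2 + t is at most |s
   - 1| + 2 + t. *)
have s2 : s <= 1 / 2.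
  have [w [aw xw]] := neighbor_toward x a ntG.
  have := gdist_tri (vpt w) x y; have := gdist_tri (vpt b) (vpt w) y; have := dle w b.
  by move: xw; rewrite -/s -/t; case: ger0P; lra.
have t2 : t <= 1 / 2.
  have [w [bw yw]] := neighbor_toward y b ntG.
  have := gdist_tri (vpt w) x y; have := gdist_tri (vpt a) x (vpt w); have := dle a w.
  by move: yw; rewrite [d (vpt w) y]dC [d y (vpt b)]dC -/s -/t; case: ger0P; lra.
(* Both parts of [xy] at p exceed 5/4, so 2 + s + t > 5/2. As s and t are at most 1/2, neither
   vanishes, and x and y are interior to edges. *)
have st : 1 / 2 < s + t by move: E px py; rewrite [d p x]dC; lra.
have [s0 t0] : 0 < s /\ 0 < t by split; lra.
have [s1 t1] : s < 1 /\ t < 1 by split; lra.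
have [x' ax' xE] := edge_of_near_vertex s0 s1 (erefl : d x (vpt a) = s).
have [y' by' yE] : exists2 c, adj b c & coord y = seg b c t.
  by apply: edge_of_near_vertex => //; rewrite dC.
have xx' : d x (vpt x') <= 1 - s by apply: edge_end ax' _ xE; lra.
have yy' : d y (vpt y') <= 1 - t by apply: edge_end by' _ yE; lra.
have ya : d y (vpt b) = t by rewrite dC.
have apart u v r r' : d x (vpt u) <= r -> d y (vpt v) <= r' -> r + r' + 1 < 2 + s + t ->
    (1 < vdist u v)%N.
  move=> xu yv rr; rewrite ltnNge -(ler_nat R) -gdist_vpt; apply/negP => uv.
  have := gdist_tri (vpt u) x y; have := gdist_tri (vpt v) (vpt u) y.
  by rewrite [d (vpt v) y]dC; lra.
have ab : (1 < vdist a b)%N by apply: (apart a b s t); rewrite ?ya//; lra.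
have x'b : (1 < vdist x' b)%N by apply: (apart x' b (1 - s) t); rewrite ?ya//; lra.
have ay' : (1 < vdist a y')%N by apply: (apart a y' s (1 - t)); rewrite //; lra.
have x'y' : (1 < vdist x' y')%N by apply: (apart x' y' (1 - s) (1 - t)); rewrite //; lra.
(* As p is within 1/4 of m, a neighbour of m is within 5/4 of p; so no vertex close enough to the
   other two sides is m or adjacent to m. *)
have near q w r : (B `|` C) q -> d q (vpt w) <= r -> 1 / 4 + 1 + r <= e ->
    (1 < vdist w m)%N.
  move=> /far pq qw re; rewrite ltnNge -(ler_nat R) -gdist_vpt; apply/negP => wm.
  have := gdist_tri (vpt m) p q; have := gdist_tri (vpt w) (vpt m) q.
  by rewrite [d (vpt m) (vpt w)]dC [d (vpt w) q]dC; lra.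
have on_side w : (B `|` C) (vpt w) -> (1 < vdist w m)%N.
  by move=> BCw; apply: (near (vpt w) w 0) => //; rewrite ?gdistxx; lra.
have bm : adj b m by rewrite adj_sym.
have x_supp w : 0 < x w -> w = a \/ w = x' by rewrite xE => /seg_supp.
have y_supp w : 0 < y w -> w = b \/ w = y' by rewrite yE => /seg_supp.
have disj w : 0 < x w -> 0 < y w -> False.
  by move=> /x_supp[]-> /y_supp[] wE; move: ab x'b ay' x'y'; rewrite wE ?vdistxx//.
have e0 : 0 < e - 5 / 4 by lra.
(* The other two sides lead from x to y and so leave {a, x'}, passing close to one of these two
   vertices. It cannot be a, a neighbour of m, so it is x'. *)
have x'm : (1 < vdist x' m)%N.
  have [||q [w [w' [CBq Sw _ _ qw]]]] :=
      @crossing R G (pred2 a x') _ _ _ _ _ _ e0 xz zy.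
  - by move=> w /x_supp[]->; rewrite /= eqxx ?orbT.
  - move=> w yw; apply/negP => /orP[]/eqP wE; subst w; apply: disj yw.
      by rewrite xE segl// subr_gt0.
    by rewrite xE segr.
  have wm : (1 < vdist w m)%N.
    apply: (near q w (e - 5 / 4)) => //; last by lra.
    by case: CBq; [right|left].
  case/orP: Sw => /eqP wE; subst w => //.
  by have := vdist_adj am; rewrite leqNgt wm.
have y'm : (1 < vdist y' m)%N.
  have [||q [w [w' [BCq Sw _ _ qw]]]] :=
      @crossing R G (pred2 b y') _ _ _ _ _ _ e0 yz zx.
  - by move=> w /y_supp[]->; rewrite /= eqxx ?orbT.
  - move=> w xw; apply/negP => /orP[]/eqP wE; subst w; apply: (disj _ xw).
      by rewrite yE segl// subr_gt0.
    by rewrite yE segr.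
  have wm : (1 < vdist w m)%N by apply: (near q w (e - 5 / 4)) => //; lra.
  case/orP: Sw => /eqP wE; subst w => //.
  by have := vdist_adj bm; rewrite leqNgt wm.
have Ca : ~ C (vpt a).
  by move=> Ca; have := vdist_adj am; rewrite leqNgt on_side//; right.
have Bb : ~ B (vpt b).
  by move=> Bb; have := vdist_adj bm; rewrite leqNgt on_side//; left.
have [s1' [x's s1'2 Cs1 zs1 zx'E]] := side_walk D2 xz ax' s0 s2 xE Ca.
have [s5 [y's s52 Bs5 zs5 zy'E]] := side_walk D2 yz by' t0 t2 yE Bb.
exists x', a, m, b, y', s1', s5; split.
- by rewrite /= am mb by' adj_sym ax'.
- by split.
- by split.
- move=> w; rewrite mem_cat !inE => /orP[]/predU1P[->//|ws]; apply: on_side.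
    by right; apply: Cs1.
  by left; apply: Bs5.
split=> //.
- exact: supp_adj zs1 zs5.
- move=> s12 w wE; apply: side_far s0 s2 (erefl _) _ zs1 zs5 wE.
  by rewrite zx'E ?s12//; case: (s1') s12.
- move=> s52' w wE; apply: side_far t0 t2 ya _ zs5 zs1 _.
    by rewrite zy'E ?s52'//; case: (s5) s52'.
  by case: wE; [right|left].
Qed.

End FarConfiguration.

(** * Recognizing the family F *)

Section InducedFamilies.
Variable G : graph.
Implicit Types u v w : G.

Definition apart u v : bool := (u != v) && ~~ adj u v.

Lemma apart_sym u v : apart u v = apart v u.
Proof. by rewrite /apart eq_sym adj_sym. Qed.

Lemma apart_adj_neq u v w : apart u v -> adj w v -> u != w.
Proof. by move=> /andP[_ uv] wv; apply: contraNneq uv => ->. Qed.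

Lemma labelled_adjC n chords i j : labelled_adj n chords i j = labelled_adj n chords j i.
Proof. by rewrite /labelled_adj orbC. Qed.

Lemma labelled_adj_cat n chords i j : labelled_adj n chords i j =
  labelled_adj n [::] i j || ((i, j) \in chords) || ((j, i) \in chords).
Proof. by rewrite /labelled_adj cats0 !mem_cat orbACA orbA. Qed.

(* The chords are those allowed pairs which happen to be adjacent. *)
Lemma family_intro n allowed (V : nat -> G) : (n, allowed) \in chord_families ->
  all (fun c => adj (V c.1) (V c.2)) (cycle_edges n) ->
  all (fun c => V c.1 != V c.2) allowed ->
  all (fun c => (c.1 < c.2)%N ==> labelled_far n allowed c.1 c.2 ==>
    apart (V c.1) (V c.2)) [seq (i, j) | i <- iota 1 n, j <- iota 1 n] ->
  family_F G.
Proof.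
move=> nF /allP Vadj /allP Vneq /allP Vfar.
pose chords := [seq c <- allowed | adj (V c.1) (V c.2)].
have edge i j : labelled_adj n [::] i j -> adj (V i) (V j).
  by rewrite /labelled_adj cats0 => /orP[/Vadj|/Vadj]//=; rewrite adj_sym.
have far i j : labelled_far n allowed i j -> apart (V i) (V j).
  have main i' j' : (i' < j')%N -> labelled_far n allowed i' j' -> apart (V i') (V j').
    move=> ij far; have /and4P[im jm _ _] := far.
    have /Vfar/= : (i', j') \in [seq (i, j) | i <- iota 1 n, j <- iota 1 n].
      exact: allpairs_f.
    by rewrite ij far.
  move=> ijfar; have /and4P[im jm ij nij] := ijfar.
  move: (ij); rewrite neq_ltn => /orP[/main|/main]; first exact.
  by rewrite apart_sym; apply; rewrite /labelled_far jm im eq_sym ij labelled_adjC.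
exists n, allowed, chords; split=> //; first by move=> c; rewrite mem_filter => /andP[].
have mem_iota1 (i : 'I_n) : i.+1 \in iota 1 n by rewrite mem_iota /= add1n ltnS.
exists (fun i : 'I_n => V i.+1) => [i j|i j].
  move=> /= Vij; apply/eqP/negPn/negP => ij.
  have : labelled_adj n allowed i.+1 j.+1.
    apply/negPn/negP => nij; have : apart (V i.+1) (V j.+1).
      by apply: far; rewrite /labelled_far !mem_iota1 eqSS nij andbT.
    by rewrite /apart Vij eqxx.
  rewrite labelled_adj_cat => /orP[/orP[/edge|/Vneq/=]|/Vneq/=].
  - by rewrite Vij adj_irr.
  - by rewrite Vij eqxx.
  - by rewrite Vij eqxx.
rewrite -[RHS]/(labelled_adj n chords i.+1 j.+1) labelled_adj_cat !mem_filter /=.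
rewrite [adj (V j.+1) _]adj_sym.
have [->|ij] := eqVneq i j.
  rewrite adj_irr /= orbF; apply/esym/negP => /orP[/edge|//].
  by rewrite adj_irr.
apply/idP/idP => [ijadj|/orP[/orP[/edge//|/andP[]//]|/andP[]//]].
rewrite ijadj /= -labelled_adj_cat; apply/negPn/negP => nij.
suff : apart (V i.+1) (V j.+1) by rewrite /apart ijadj andbF.
by apply: far; rewrite /labelled_far !mem_iota1 eqSS nij andbT.
Qed.

End InducedFamilies.

Section ClosingPaths.
Variables (G : graph) (v1 v2 v3 v4 v5 : G).
Hypotheses (e12 : adj v1 v2) (e23 : adj v2 v3) (e34 : adj v3 v4) (e45 : adj v4 v5).
Hypotheses (a14 : apart v1 v4) (a15 : apart v1 v5) (a24 : apart v2 v4)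
  (a25 : apart v2 v5) (a13 : apart v1 v3) (a35 : apart v3 v5).

(** Pairs allowed as chords may or may not be adjacent, so their distinctness needs its own
    argument: v2 and v4 are adjacent to v3, while w is not. *)
Let chord_neq w : apart v3 w -> (v2 != w) * (v4 != w).
Proof.
move=> a; have e43 : adj v4 v3 by rewrite adj_sym.
by split; rewrite eq_sym (apart_adj_neq _ e23, apart_adj_neq _ e43)// apart_sym.
Qed.

(* The first entry is a dummy, since labels start at 1. *)
Let V ws k := nth v1 [:: v1, v1, v2, v3, v4, v5 & ws] k.

(** In this lemma and the next ones the number counts the edges of the path that leads from v5 back
    to v1. *)
Lemma family_path2 w : adj v5 w -> adj w v1 -> apart v3 w -> family_F G.
Proof.
move=> e56 e61 a36.
apply: (@family_intro G 6 [:: (2, 6); (4, 6)] (V [:: w]));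
  rewrite /= ?e12 ?e23 ?e34 ?e45 ?e56 ?e61 ?chord_neq//=.
by rewrite a13 a14 a15 a24 a25 a35 a36.
Qed.

(** A coincidence or a forbidden adjacency among the new vertices, v1 and v5 either contradicts
    [a15] or gives a shorter closing path. The longer paths below are treated by the same
    reduction. *)
Lemma family_path3 w6 w7 : adj v5 w6 -> adj w6 w7 -> adj w7 v1 ->
  apart v3 w6 -> apart v3 w7 -> family_F G.
Proof.
move=> e56 e67 e71 a36 a37.
have [a57|] := boolP (apart v5 w7); last first.
  rewrite negb_and !negbK => /orP[/eqP ?|e57]; last exact: family_path2 e57 e71 _.
  by subst w7; move: a15; rewrite apart_sym /apart e71 andbF.
have [a16|] := boolP (apart v1 w6); last first.
  rewrite negb_and !negbK => /orP[/eqP ?|e16].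
    by subst w6; move: a15; rewrite apart_sym /apart e56 andbF.
  by apply: (@family_path2 w6) => //; rewrite adj_sym.
apply: (@family_intro G 7 [:: (2, 6); (2, 7); (4, 6); (4, 7)] (V [:: w6; w7]));
  rewrite /= ?e12 ?e23 ?e34 ?e45 ?e56 ?e67 ?e71 ?chord_neq//=.
by rewrite a13 a14 a15 a16 a24 a25 a35 a36 a37 a57.
Qed.

Lemma path4_cases w6 w7 w8 : adj v5 w6 -> adj w6 w7 -> adj w7 w8 -> adj w8 v1 ->
  apart v3 w6 -> apart v3 w7 -> apart v3 w8 ->
  family_F G \/ [/\ apart v1 w6, apart v1 w7, apart v5 w7, apart v5 w8 & apart w6 w8].
Proof.
move=> e56 e67 e78 e81 a36 a37 a38.
have [a16|] := boolP (apart v1 w6); last first.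
  rewrite negb_and !negbK => /orP[/eqP ?|e16]; left.
    by subst w6; move: a15; rewrite apart_sym /apart e56 andbF.
  by apply: (@family_path2 w6) => //; rewrite adj_sym.
have [a17|] := boolP (apart v1 w7); last first.
  rewrite negb_and !negbK => /orP[/eqP ?|e17]; left.
    by subst w7; apply: (@family_path2 w6).
  by apply: (@family_path3 w6 w7) => //; rewrite adj_sym.
have [a58|] := boolP (apart v5 w8); last first.
  rewrite negb_and !negbK => /orP[/eqP ?|e58]; left; last exact: (@family_path2 w8).
  by subst w8; move: a15; rewrite apart_sym /apart e81 andbF.
have [a57|] := boolP (apart v5 w7); last first.
  rewrite negb_and !negbK => /orP[/eqP ?|e57]; left; last exact: (@family_path3 w7 w8).
  by subst w7; apply: (@family_path2 w8).
have [a68|] := boolP (apart w6 w8); last first.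
  rewrite negb_and !negbK => /orP[/eqP ?|e68]; left; last exact: (@family_path3 w6 w8).
  by subst w8; apply: (@family_path2 w6).
by right.
Qed.

Lemma family_path4_vertex w6 w7 w8 :
  adj v5 w6 -> adj w6 w7 -> adj w7 w8 -> adj w8 v1 ->
  apart v3 w6 -> apart v3 w7 -> apart v3 w8 -> apart v2 w7 -> apart v4 w7 ->
  family_F G.
Proof.
move=> e56 e67 e78 e81 a36 a37 a38 a27 a47.
have [//|[a16 a17 a57 a58 a68]] := path4_cases e56 e67 e78 e81 a36 a37 a38.
apply: (@family_intro G 8 [:: (2, 6); (2, 8); (4, 6); (4, 8)] (V [:: w6; w7; w8]));
  rewrite /= ?e12 ?e23 ?e34 ?e45 ?e56 ?e67 ?e78 ?e81 ?chord_neq//=.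
by rewrite a13 a14 a15 a16 a17 a24 a25 a27 a35 a36 a37 a38 a47 a57 a58 a68.
Qed.

(** This 8-cycle arises from walks of unequal sizes, 2 from v1 and 1 from v5, whose last vertices w7
    and w6 are adjacent; the previous one arises from two walks of size 2 with a common last
    vertex. *)
Lemma family_path4_edge w6 w7 w8 :
  adj v5 w6 -> adj w6 w7 -> adj w7 w8 -> adj w8 v1 ->
  apart v3 w6 -> apart v3 w7 -> apart v3 w8 -> apart v2 w6 -> apart v2 w7 ->
  family_F G.
Proof.
move=> e56 e67 e78 e81 a36 a37 a38 a26 a27.
have [//|[a16 a17 a57 a58 a68]] := path4_cases e56 e67 e78 e81 a36 a37 a38.
apply: (@family_intro G 8 [:: (2, 8); (4, 6); (4, 7); (4, 8)] (V [:: w6; w7; w8]));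
  rewrite /= ?e12 ?e23 ?e34 ?e45 ?e56 ?e67 ?e78 ?e81 ?chord_neq//=.
by rewrite a13 a14 a15 a16 a17 a24 a25 a26 a27 a35 a36 a37 a38 a57 a58 a68.
Qed.

Lemma family_path5 w6 w7 w8 w9 :
  adj v5 w6 -> adj w6 w7 -> adj w7 w8 -> adj w8 w9 -> adj w9 v1 ->
  apart v3 w6 -> apart v3 w7 -> apart v3 w8 -> apart v3 w9 ->
  apart v2 w7 -> apart v2 w8 -> apart v4 w7 -> apart v4 w8 -> family_F G.
Proof.
move=> e56 e67 e78 e89 e91 a36 a37 a38 a39 a27 a28 a47 a48.
have [a16|] := boolP (apart v1 w6); last first.
  rewrite negb_and !negbK => /orP[/eqP ?|e16].
    by subst w6; move: a15; rewrite apart_sym /apart e56 andbF.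
  by apply: (@family_path2 w6) => //; rewrite adj_sym.
have [a17|] := boolP (apart v1 w7); last first.
  rewrite negb_and !negbK => /orP[/eqP ?|e17].
    by subst w7; apply: (@family_path2 w6).
  by apply: (@family_path3 w6 w7) => //; rewrite adj_sym.
have [a18|] := boolP (apart v1 w8); last first.
  rewrite negb_and !negbK => /orP[/eqP ?|e18].
    by subst w8; apply: (@family_path3 w6 w7).
  by apply: (@family_path4_vertex w6 w7 w8) => //; rewrite adj_sym.
have [a59|] := boolP (apart v5 w9); last first.
  rewrite negb_and !negbK => /orP[/eqP ?|e59]; last exact: (@family_path2 w9).
  by subst w9; move: a15; rewrite apart_sym /apart e91 andbF.
have [a58|] := boolP (apart v5 w8); last first.
  rewrite negb_and !negbK => /orP[/eqP ?|e58]; last exact: (@family_path3 w8 w9).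
  by subst w8; apply: (@family_path2 w9).
have [a57|] := boolP (apart v5 w7); last first.
  rewrite negb_and !negbK => /orP[/eqP ?|e57]; last exact: (@family_path4_vertex w7 w8 w9).
  by subst w7; apply: (@family_path3 w8 w9).
have [a69|] := boolP (apart w6 w9); last first.
  rewrite negb_and !negbK => /orP[/eqP ?|e69]; last exact: (@family_path3 w6 w9).
  by subst w9; apply: (@family_path2 w6).
have [a68|] := boolP (apart w6 w8); last first.
  rewrite negb_and !negbK => /orP[/eqP ?|e68]; last exact: (@family_path4_vertex w6 w8 w9).
  by subst w8; apply: (@family_path3 w6 w9).
have [a79|] := boolP (apart w7 w9); last first.
  rewrite negb_and !negbK => /orP[/eqP ?|e79]; last exact: (@family_path4_vertex w6 w7 w9).
  by subst w9; apply: (@family_path3 w6 w7).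
apply: (@family_intro G 9 [:: (2, 6); (2, 9); (4, 6); (4, 9)] (V [:: w6; w7; w8; w9]));
  rewrite /= ?e12 ?e23 ?e34 ?e45 ?e56 ?e67 ?e78 ?e89 ?e91 ?chord_neq//=.
rewrite a13 a14 a15 a16 a17 a18 a24 a25 a27 a28 a35 a36 a37 a38 a39 a47 a48 a57 a58 a59.
by rewrite a68 a69 a79.
Qed.

End ClosingPaths.

(** Followed by the reverse of s1, the walk s5 leads from v5 back to v1. Nine pairs of sizes arise,
    each with the last vertices equal or adjacent; a walk of size 2 supplies the apartness from v2
    or v4 that the 8- and 9-cycles require. *)
Lemma family_of_walks (G : graph) (v1 v2 v3 v4 v5 : G) (s1 s5 : seq G) :
  path (@adj G) v1 [:: v2; v3; v4; v5] ->
  [/\ apart v1 v4, apart v1 v5, apart v2 v4 & apart v2 v5] ->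
  path (@adj G) v1 s1 -> path (@adj G) v5 s5 ->
  all (apart v3) ((v1 :: s1) ++ (v5 :: s5)) -> (size s1 <= 2)%N -> (size s5 <= 2)%N ->
  last v1 s1 = last v5 s5 \/ adj (last v1 s1) (last v5 s5) ->
  (size s1 = 2 -> apart v2 (last v1 s1) /\ apart v2 (last v5 s5)) ->
  (size s5 = 2 -> apart v4 (last v1 s1) /\ apart v4 (last v5 s5)) -> family_F G.
Proof.
move=> /= /and5P[e12 e23 e34 e45 _] [a14 a15 a24 a25] p1 p5.
rewrite all_cat /= => /and4P[a31 far1 a35 far5].
have a13 : apart v1 v3 by rewrite apart_sym.
have path2 := family_path2 e12 e23 e34 e45 a14 a15 a24 a25 a13 a35.
have path3 := family_path3 e12 e23 e34 e45 a14 a15 a24 a25 a13 a35.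
have path4v := family_path4_vertex e12 e23 e34 e45 a14 a15 a24 a25 a13 a35.
have path4e := family_path4_edge e12 e23 e34 e45 a14 a15 a24 a25 a13 a35.
have path5 := family_path5 e12 e23 e34 e45 a14 a15 a24 a25 a13 a35.
have [n15 na15] : v1 <> v5 /\ ~ adj v1 v5 by move: (a15) => /andP[/eqP ? /negP].
case: s1 p1 far1 => [|b1 [|b2 [|//]]] /= p1 far1 _;
  case: s5 p5 far5 => [|c1 [|c2 [|//]]] /= p5 far5 _ lastE far2 far4.
- by case: lastE.
- case/andP: p5 => p5 _; case/andP: far5 => far5 _.
  by case: lastE => [E|E]; [rewrite E adj_sym in na15|apply: (path2 c1); rewrite // adj_sym].
- case/and3P: p5 => p5 p5' _; case/and3P: far5 => far5 far5' _.
  case: lastE => [E|E]; first by subst c2; apply: (path2 c1).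
  by apply: (path3 c1 c2); rewrite // adj_sym.
- case/andP: p1 => p1 _; case/andP: far1 => far1 _.
  by case: lastE => [E|E]; [subst b1|apply: (path2 b1); rewrite // adj_sym].
- case/andP: p1 => p1 _; case/andP: far1 => far1 _.
  case/andP: p5 => p5 _; case/andP: far5 => far5 _.
  case: lastE => [E|E]; first by subst b1; apply: (path2 c1); rewrite // adj_sym.
  by apply: (path3 c1 b1); rewrite // adj_sym.
- case/andP: p1 => p1 _; case/andP: far1 => far1 _.
  case/and3P: p5 => p5 p5' _; case/and3P: far5 => far5 far5' _.
  case: lastE => [E|E]; first by subst c2; apply: (path3 c1 b1); rewrite // adj_sym.
  have [a4b a4c] := far4 erefl.
  (* Here the longer walk starts from v5, so the 8-cycle is labelled in the reverse order v5, v4,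
     v3, v2, v1. *)
  have [a41 a51 a42 a52] : [/\ apart v4 v1, apart v5 v1, apart v4 v2 & apart v5 v2].
    by rewrite ![apart v4 _]apart_sym ![apart v5 _]apart_sym.
  have a53 : apart v5 v3 by rewrite apart_sym.
  by apply: (@family_path4_edge G v5 v4 v3 v2 v1 _ _ _ _ _ _ _ _ _ _ b1 c2 c1);
    rewrite // adj_sym.
- case/and3P: p1 => p1 p1' _; case/and3P: far1 => far1 far1' _.
  case: lastE => [E|E]; first by subst b2; apply: (path2 b1); rewrite // adj_sym.
  by apply: (path3 b2 b1); rewrite // adj_sym.
- case/and3P: p1 => p1 p1' _; case/and3P: far1 => far1 far1' _.
  case/andP: p5 => p5 _; case/andP: far5 => far5 _.
  case: lastE => [E|E]; first by subst c1; apply: (path3 b2 b1); rewrite // adj_sym.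
  have [a2b a2c] := far2 erefl.
  by apply: (path4e c1 b2 b1); rewrite // adj_sym.
- case/and3P: p1 => p1 p1' _; case/and3P: far1 => far1 far1' _.
  case/and3P: p5 => p5 p5' _; case/and3P: far5 => far5 far5' _.
  have [[a2b a2c] [a4b a4c]] := (far2 erefl, far4 erefl).
  case: lastE => [E|E]; last by apply: (path5 c1 c2 b2 b1); rewrite // adj_sym.
  by subst c2; apply: (path4v c1 b2 b1); rewrite // adj_sym.
Qed.

Lemma vdist_apart (G : graph) (u v : G) : (1 < vdist u v)%N -> apart u v.
Proof.
move=> uv; apply/andP; split; first by apply: contraTneq uv => ->; rewrite vdistxx.
by apply: contraTN uv => /vdist_adj; rewrite leqNgt.
Qed.

(** * Products over a star *)

Definition star_center (G : graph) (c : G) := forall u v : G, adj u v -> u = c \/ v = c.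

Section Stars.
Variables (G : graph) (c : G).
Hypotheses (star : star_center c) (ntG : ~ trivial_graph G).

Lemma star_adj u : u <> c -> adj u c.
Proof.
by move=> uc; have [v uv] := exists_adj ntG u; case: (star uv) => [//|<-].
Qed.

Lemma star_diam (R : realType) : (diam R G <= (2%:R : R)%:E)%E.
Proof.
have near (x : point R G) : gdist x (vpt R c) <= 1.
  have [[u ->]|[u [v [t [uv /andP[t0 t1] xE]]]]] := point_rep x.
    rewrite gdist_vpt (ler_nat _ _ 1); have [->|/eqP/star_adj/vdist_adj//] := eqVneq u c.
    by rewrite vdistxx.
  have xc : 0 < x c.
    by have [<-|<-] := star uv; rewrite xE ?segl ?segr// subr_gt0.
  by apply: le_trans (gdist_supp xc) _; rewrite lerBlDr lerDl ltW.
apply: ge_ereal_sup => _ [[x y] _ <-]; rewrite lee_fin /=.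
have := gdist_tri (vpt R c) x y; have := near x; have := near y.
by rewrite [gdist y _]gdistC -[2%:R]/(2 : R); lra.
Qed.

Lemma star_lex_vdist (G2 : graph) (v w : lex_product G G2) : (vdist v w <= 2)%N.
Proof.
have [vw|vw] := eqVneq v.1 w.1; first exact: vdist_fibre.
have [vc|/eqP vc] := eqVneq v.1 c.
  have wc : w.1 <> c by rewrite -vc; apply/eqP; rewrite eq_sym.
  by rewrite leqW// vdist_adj// adj_fst// vc adj_sym star_adj.
have [wc|/eqP wc] := eqVneq w.1 c.
  by rewrite leqW// vdist_adj// adj_fst// wc star_adj.
apply: (@vdist_le2 _ v w (c, v.2)); apply: adj_fst; rewrite /= ?star_adj//.
by rewrite adj_sym star_adj.
Qed.

(** The fibre over c is completely joined to all other fibres. *)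
Lemma star_far_center (G2 : graph) (v w : lex_product G G2) : (1 < vdist v w)%N ->
  (v.1 = c <-> w.1 = c).
Proof.
move=> vw; have nvw : ~ adj v.1 w.1.
  by move=> /adj_fst/vdist_adj; rewrite leqNgt vw.
split=> E; apply: contrapT => /star_adj; rewrite -E //.
by rewrite adj_sym.
Qed.

(** Every edge of the star contains c, so a path that avoids the fibre over c cannot change
    fibre. *)
Lemma star_path_fibre (G2 : graph) (v : lex_product G G2) s :
  path (@adj (lex_product G G2)) v s -> v.1 <> c -> (forall w, w \in s -> w.1 <> c) ->
  forall w, w \in v :: s -> w.1 = v.1.
Proof.
elim: s v => [|u s IHs] v /=; first by move=> _ _ _ w; rewrite inE => /eqP ->.
move=> /andP[vu us] vc sc w; rewrite inE => /predU1P[->//|ws].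
have uc : u.1 <> c by apply: sc; rewrite inE eqxx.
have uv : u.1 = v.1.
  by have [//|/star[]] := adj_lex_cases vu.
by rewrite -uv; apply: IHs ws => // w' w's; apply: sc; rewrite inE w's orbT.
Qed.

Lemma star_family (R : realType) (G2 : graph) :
  ((5 / 4 : R)%:E < hyp_const R (lex_product G G2))%E -> family_F G2.
Proof.
set H := lex_product G G2 => hyp54; apply: contrapT => nF.
suff : (hyp_const R H <= (5 / 4 : R)%:E)%E by rewrite leNgt hyp54.
apply: delta_space_le => [||x y z A B C p e e54 xy yz zx Ap far].
- exact: gdist_ge0.
- by lra.
apply: nF.
have [v1 [v2 [v3 [v4 [v5 [s1 [s5 [W [v14 v15 v24 v25] [p1 p5] farv3
  [s12 s52 lastE far2 far4]]]]]]]]] :=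
  far_configuration (@star_lex_vdist G2) e54 xy yz zx Ap far.
pose S := [:: v1; v2; v3; v4; v5] ++ s1 ++ s5.
have S1 w : w \in v1 :: s1 -> w \in S.
  by rewrite /S !(inE, mem_cat) => /orP[]->; rewrite ?orbT.
have S5 w : w \in v5 :: s5 -> w \in S.
  by rewrite /S !(inE, mem_cat) => /orP[]->; rewrite ?orbT.
(* If v3 lies over c, so does every vertex far from it, and v2 and v4 follow from the pairs (v2, v5)
   and (v1, v4). Otherwise all these vertices avoid the fibre over c, and the walks joining them
   stay in one fibre. *)
have [u uE] : exists u, forall w, w \in S -> w.1 = u.
  exists v3.1 => w.
  have far1 w' : w' \in v1 :: s1 -> (w'.1 = c <-> v3.1 = c).
    by move=> ws; apply: star_far_center; apply: farv3; rewrite mem_cat ws.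
  have far5 w' : w' \in v5 :: s5 -> (w'.1 = c <-> v3.1 = c).
    by move=> ws; apply: star_far_center; apply: farv3; rewrite mem_cat ws orbT.
  have v2c := star_far_center v25; have v4c := star_far_center v14.
  have v1c := far1 v1 (mem_head _ _); have v5c := far5 v5 (mem_head _ _).
  have [c3|c3] := pselect (v3.1 = c).
    rewrite c3 /S !(inE, mem_cat).
    move=> /orP[/or4P[/eqP->|/eqP->|/eqP->|/orP[/eqP->|/eqP->]]|/orP[ws|ws]]; try tauto.
      by apply/far1 => //; rewrite inE ws orbT.
    by apply/far5 => //; rewrite inE ws orbT.
  have WE : forall w, w \in [:: v1; v2; v3; v4; v5] -> w.1 = v1.1.
    apply: star_path_fibre W _ _; first tauto.
    by move=> w'; rewrite !inE => /or4P[]/eqP->; tauto.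
  have v13 : v3.1 = v1.1 by apply: WE; rewrite !inE eqxx ?orbT.
  have v15' : v5.1 = v1.1 by apply: WE; rewrite !inE eqxx ?orbT.
  rewrite v13 /S !mem_cat => /orP[/WE//|/orP[ws|ws]].
    apply: (star_path_fibre p1); first tauto; last by rewrite inE ws orbT.
    by move=> w' w's; rewrite far1// inE w's orbT.
  rewrite -v15'; apply: (star_path_fibre p5); first tauto; last by rewrite inE ws orbT.
  by move=> w' w's; rewrite far5// inE w's orbT.
have adjE v w : v \in S -> w \in S -> adj v w = adj v.2 w.2.
  by move=> /uE vE /uE wE; rewrite adj_lexE vE wE adj_irr eqxx.
have apartE v w : v \in S -> w \in S -> (1 < vdist v w)%N -> apart v.2 w.2.
  move=> vS wS /vdist_apart; rewrite /apart adjE// => /andP[vw ->]; rewrite andbT.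
  apply: contraNneq vw => vw; rewrite [v]surjective_pairing [w]surjective_pairing.
  by rewrite vw uE// uE.
have pathE v s : path (@adj H) v s -> {subset v :: s <= S} ->
    path (@adj G2) v.2 (map snd s).
  elim: s v => // w s IHs v /andP[vw ws] vsS; apply/andP; split.
    by rewrite -adjE//; apply: vsS; rewrite !inE eqxx ?orbT.
  by apply: IHs => // w' w's; apply: vsS; rewrite inE w's orbT.
have [Sv1 Sv2 Sv3] : [/\ v1 \in S, v2 \in S & v3 \in S] by rewrite !inE !eqxx !orbT.
have [Sv4 Sv5] : v4 \in S /\ v5 \in S by rewrite !inE !eqxx !orbT.
have lS1 : last v1 s1 \in S by apply: S1; apply: mem_last.
have lS5 : last v5 s5 \in S by apply: S5; apply: mem_last.
apply: (@family_of_walks G2 v1.2 v2.2 v3.2 v4.2 v5.2 (map snd s1) (map snd s5)).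
- apply: (pathE v1 [:: v2; v3; v4; v5] W) => w.
  by rewrite /S mem_cat => ->.
- by split; apply: apartE.
- exact: pathE p1 S1.
- exact: pathE p5 S5.
- rewrite -!map_cons -map_cat; apply/allP => _ /mapP[w ws ->].
  rewrite apart_sym apartE//; last exact: farv3.
  by move: ws; rewrite mem_cat => /orP[/S1|/S5].
- by rewrite size_map.
- by rewrite size_map.
- by rewrite !(last_map snd) -adjE//; case: lastE => [->|]; [left|right].
- rewrite size_map !(last_map snd) => /far2 h.
  by split; apply: apartE => //; apply: h; [left|right].
- rewrite size_map !(last_map snd) => /far4 h.
  by split; apply: apartE => //; apply: h; [left|right].
Qed.

End Stars.

(** * Trees and the theorem *)

Section GraphIsomorphism.
Variables (R : realType) (K L : graph) (h : K -> L) (h' : L -> K).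
Hypotheses (hK : cancel h h') (h'K : cancel h' h)
  (h_adj : forall u v, adj (h u) (h v) = adj u v).

Lemma vtx_iso u : vtx R (h u) \o h = vtx R u.
Proof. by apply/funext => w /=; rewrite !vtxE (can_eq hK). Qed.

Lemma seg_iso u v (t : R) : seg (h u) (h v) t \o h = seg u v t.
Proof. by apply/funext => w /=; rewrite !segE !(can_eq hK). Qed.

Lemma is_point_iso (x : point R L) : is_point (coord x \o h).
Proof.
have [[u ->]|[u [v [t [uv t01 ->]]]]] := coordP x.
  by left; exists (h' u); rewrite -{1}(h'K u) vtx_iso.
right; exists (h' u), (h' v), t; rewrite -h_adj !h'K uv; split=> //.
by rewrite -{1}(h'K u) -{1}(h'K v) seg_iso.
Qed.

(** Points are functions on vertices, so h acts contravariantly on them. *)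
Definition pullback (x : point R L) : point R K := Point (is_point_iso x).

Lemma path_length_iso x y l : path_length x y l -> path_length (pullback x) (pullback y) l.
Proof.
elim=> [z|z w q u v s t {}l uv s01 t01 zE wE _ IH]; first exact: path_length_nil.
have uv' : adj (h' u) (h' v) by rewrite -h_adj !h'K.
apply: (path_length_cons uv' s01 t01 _ _ IH) => /=.
  by rewrite zE -{1}(h'K u) -{1}(h'K v) seg_iso.
by rewrite wE -{1}(h'K u) -{1}(h'K v) seg_iso.
Qed.

Lemma gdist_iso_le x y : gdist (pullback x) (pullback y) <= gdist x y.
Proof. by apply: le_gdist => l /path_length_iso; apply: gdist_le. Qed.

End GraphIsomorphism.

Lemma hyp_const_iso_le (R : realType) (K L : graph) (h : K -> L) (h' : L -> K) :
  cancel h h' -> cancel h' h -> (forall u v, adj (h u) (h v) = adj u v) ->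
  (hyp_const R L <= hyp_const R K)%E.
Proof.
move=> hK h'K h_adj.
have h'_adj u v : adj (h' u) (h' v) = adj u v by rewrite -h_adj !h'K.
pose f := @pullback R K L h h' hK h'K h_adj.
pose g := @pullback R L K h' h h'K hK h'_adj.
have fK : cancel f g.
  by move=> x; apply: point_eq; apply/funext => w; rewrite /= h'K.
apply: (@delta_space_isometry_le R _ _ _ _ f) => x y; apply/eqP; rewrite eq_le.
rewrite gdist_iso_le /= -{1}(fK x) -{1}(fK y); exact: gdist_iso_le.
Qed.

Section Trees.
Variables (R : realType) (T : graph).
Hypothesis treeT : tree T.

Lemma tree_no_cycle (a b c : T) s : path (@adj T) a [:: b, c & s] ->
  adj (last c s) a -> uniq [:: a, b, c & s] -> False.
Proof.
move=> W sa us; have : (size [:: a, b, c & s] < 3)%N; last by [].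
by apply: treeT; rewrite /ucycle us andbT (cycle_path a) /= sa.
Qed.

(** A route of length at most 2 from a to e would close a cycle with three, four or five
    vertices. *)
Lemma tree_vdist3 (a b c e : T) : path (@adj T) a [:: b; c; e] -> a != c -> b != e ->
  (2 < vdist a e)%N.
Proof.
move=> /= /and4P[ab bc ce _] ac be.
have [[ab' bc'] ce'] := (adj_neq ab, adj_neq bc, adj_neq ce).
have triangle (u v w : T) : adj u v -> adj v w -> adj w u -> False.
  move=> uv vw wu; apply: (@tree_no_cycle u v w [::]); rewrite /= ?uv ?vw ?wu//.
  by rewrite !inE !negb_or (adj_neq uv) (adj_neq vw) eq_sym (adj_neq wu).
have ae : a != e.
  by apply/eqP => ae; apply: (triangle a b c); rewrite // ae.
apply: (vdist_gt2 ae) => [|w aw].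
  apply/negP => ae'; apply: (@tree_no_cycle a b c [:: e]); rewrite /= ?ab ?bc ?ce//.
    by rewrite adj_sym.
  by rewrite !inE !negb_or ab' ac ae bc' be ce'.
apply/negP => we; have [wb|wb] := eqVneq w b.
  by apply: (triangle b c e); rewrite // adj_sym -wb.
have [wc|wc] := eqVneq w c.
  by apply: (triangle a b c); rewrite // adj_sym -wc.
have [ew wa] : adj e w /\ adj w a by rewrite adj_sym [adj w a]adj_sym.
apply: (@tree_no_cycle a b c [:: e; w]); rewrite /= ?ab ?bc ?ce ?ew ?wa//.
rewrite !inE !negb_or ab' ac ae bc' be ce' (adj_neq aw).
by rewrite [b == w]eq_sym wb [c == w]eq_sym wc eq_sym (adj_neq we).
Qed.

(** Suppose every path of three edges backtracks. If a has two neighbours, each neighbour u of a is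
    preceded by a path w a with w different from u, so u has no neighbour but a, and a is a center.
    If no vertex has two neighbours, the graph is a single edge. *)
Lemma long_path_or_star : ~ trivial_graph T ->
  (exists a b c e : T, [/\ path (@adj T) a [:: b; c; e], a != c & b != e]) \/
  exists c : T, star_center c.
Proof.
move=> ntT; have [|noP4] := pselect (exists a b c e : T,
  [/\ path (@adj T) a [:: b; c; e], a != c & b != e]); [by left|right].
have P4 (w a u v : T) : adj w a -> adj a u -> adj u v -> w != u -> v = a.
  move=> wa au uv wu; apply: contrapT => /eqP va; apply: noP4.
  by exists w, a, u, v; split; rewrite /= ?wa ?au ?uv// eq_sym.
have [[a [b [c [ab ac bc]]]]|one] :=
    pselect (exists a b c : T, [/\ adj a b, adj a c & b != c]).
  have other u : exists2 w, adj w a & w != u.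
    have [bu|bu] := eqVneq b u; last by exists b; rewrite // adj_sym.
    by exists c; rewrite 1?adj_sym// -bu eq_sym.
  have near u : u = a \/ adj a u.
    move: u; apply: (@adj_ind T _ a); first by left.
    move=> u v uv [ua|au]; first by right; rewrite -ua.
    by have [w wa wu] := other u; left; apply: P4 wa au uv wu.
  exists a => u v uv; have [|au] := near u; first by left.
  by have [w wa wu] := other u; right; apply: P4 wa au uv wu.
have uniq_nbr (u v w : T) : adj u v -> adj u w -> v = w.
  move=> uv uw; apply: contrapT => /eqP vw; apply: one.
  by exists u, v, w.
have [a] := graph_inhabited T; have [b ab] := exists_adj ntT a.
have all_ab u : u = a \/ u = b.
  move: u; apply: (@adj_ind T _ a); first by left.
  move=> u v uv [ua|ub]; [right|left].
    by apply: uniq_nbr ab; rewrite -ua.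
  by apply: (uniq_nbr b); [rewrite -ub|rewrite adj_sym].
exists a => u v uv; have [|ub] := all_ab u; first by left.
have [|vb] := all_ab v; first by right.
by move: uv; rewrite ub vb adj_irr.
Qed.

Lemma diam_vdist (a b : T) : ((vdist a b)%:R%:E <= diam R T)%E.
Proof.
by apply: ereal_sup_ubound; exists (vpt R a, vpt R b) => //=; rewrite gdist_vpt.
Qed.

Lemma diam_trivial : trivial_graph T -> (diam R T <= 0)%E.
Proof.
move=> [v vE]; have pE (x : point R T) : x = vpt R v.
  have [[u ->]|[u [w [t [uw _ _]]]]] := point_rep x; first by rewrite (vE u).
  by move: uw; rewrite (vE u) (vE w) adj_irr.
apply: ge_ereal_sup => _ [[x y] _ <-] /=.
by rewrite (pE x) (pE y) gdistxx.
Qed.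

End Trees.

Theorem theorem3p23 (R : realType) (G1 G2 : graph)
    (hG1 : tree G1) (hG2 : ~ trivial_graph G2) :
  [/\ ((3%:R : R)%:E <= diam R G1)%E ->
        hyp_const R (lex_product G1 G2) = (3 / 2 : R)%:E,
      ((1 : R)%:E <= diam R G1)%E /\ (diam R G1 <= (2%:R : R)%:E)%E ->
        (hyp_const R (lex_product G1 G2) = (3 / 2 : R)%:E <-> family_F G2)
    & trivial_graph G1 ->
        (hyp_const R (lex_product G1 G2) = (3 / 2 : R)%:E <->
         hyp_const R G2 = (3 / 2 : R)%:E)].
Proof.
have lt_diam (c : R) : 0 < c -> (c%:E <= diam R G1)%E -> ~ trivial_graph G1.
  move=> c0 cd /(diam_trivial R) d0; have := le_trans cd d0.
  by rewrite lee_fin leNgt c0.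
split.
- move=> d3; have nt1 : ~ trivial_graph G1 by apply: lt_diam d3; rewrite ltr0n.
  have [[a [b [c [e [W ac be]]]]]|[c star]] := long_path_or_star nt1; last first.
    by have := le_trans d3 (star_diam star nt1 R); rewrite lee_fin ler_nat.
  apply/eqP; rewrite eq_le hyp_const_lex_le//=.
  have [y] := graph_inhabited G2; have [y' yy'] := exists_adj hG2 y.
  exact: bigon_lower W (tree_vdist3 hG1 W ac be) (adj_neq yy').
- move=> [d1 d2]; have nt1 : ~ trivial_graph G1 by apply: lt_diam d1; rewrite ltr01.
  have [[a [b [c [e [W ac be]]]]]|[c star]] := long_path_or_star nt1.
    have := le_trans (diam_vdist R a e) d2; rewrite lee_fin ler_nat leqNgt.
    by rewrite (tree_vdist3 hG1 W ac be).
  split=> [hypE|F2]; last first.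
    by apply/eqP; rewrite eq_le hyp_const_lex_le//= family_hyp_lower.
  by apply: (star_family star nt1 (R := R)); rewrite hypE lte_fin; lra.
- move=> [u uE]; suff -> : hyp_const R (lex_product G1 G2) = hyp_const R G2 by [].
  pose h (v : G2) : lex_product G1 G2 := (u, v).
  pose h' (w : lex_product G1 G2) : G2 := w.2.
  have hK : cancel h h' by [].
  have h'K : cancel h' h by move=> [w v]; rewrite /h /= (uE w).
  have h_adj v w : adj (h v) (h w) = adj v w by rewrite adj_lexE /= adj_irr eqxx.
  have h'_adj v w : adj (h' v) (h' w) = adj v w by rewrite -h_adj !h'K.
  by apply/eqP; rewrite eq_le (hyp_const_iso_le _ hK h'K h_adj) (hyp_const_iso_le _ h'K hK h'_adj).
Qed.
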